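(* Let $P(z)$ be a polynomial (with complex coefficients) of degree $n$ having all its zeros in $|z|\leq k$, where $0<k\leq 1$, and let $m=\min_{|z|=k}|P(z)|$. Then for all real or complex numbers $\alpha,\beta$ with $|\alpha|\geq k$, $|\beta|\leq 1$, and for all $r>0$, $p>1$, $q>1$ with $p^{-1}+q^{-1}=1$, $$n(|\alpha|-k)\left\{\int_{0}^{2\pi}\left|P(e^{i\theta})+\beta\frac{m}{k^{n-1}}\right|^r d\theta\right\}^{\frac{1}{r}}\leq\left\{\int_{0}^{2\pi}|1+k e^{i\theta}|^{pr}d\theta\right\}^{\frac{1}{pr}}\left\{\int_{0}^{2\pi}|D_\alpha P(e^{i\theta})|^{qr}d\theta\right\}^{\frac{1}{qr}}.$$
   Context: For a polynomial $P(z)$ of degree $n$ and a complex number $\alpha$, the polar derivative of $P$ with respect to $\alpha$ is $D_\alpha P(z)=nP(z)+(\alpha-z)P'(z)$. *)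

(* Defs.v *)
From HB Require Import structures.
From mathcomp Require Export all_boot all_order all_algebra.
From mathcomp Require Export complex.
From mathcomp Require Export all_classical all_reals all_analysis.

Set Implicit Arguments.
Unset Strict Implicit.
Unset Printing Implicit Defensive.

Import Order.TTheory GRing.Theory Num.Theory.
Local Open Scope classical_set_scope.
Local Open Scope ring_scope.
Local Open Scope complex_scope.

(* [normc] is the R-valued modulus of the complex numbers R[i]; the norm
   [`| z |] on R[i] is its image in R[i]. *)
Notation normc := ComplexField.Normc.normc.

Definition expi (R : realType) (t : R) : R[i] := cos t +i* sin t.

(* [(size P).-1] is the degree of P. *)
Definition polar_derivative (R : realType) (alpha : R[i]) (P : {poly R[i]}) :
    {poly R[i]} :=
  P *+ (size P).-1 + (alpha%:P - 'X) * P^`().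

Definition is_min (R : realType) (A : set R) (m : R) : Prop :=
  A m /\ lbound A m.

(* {\int_0^{2pi} |f(e^{i theta})|^s d theta}^{1/s}, without the factor 1/(2pi). *)
Definition circle_Lnorm (R : realType) (s : R) (f : R[i] -> R[i]) : R :=
  (\int[@lebesgue_measure R]_(t in `[0, 2 * pi])
     (normc (f (expi t)) `^ s)) `^ s^-1.

(* Main.v *)
(* On |z| = 1 one has k |P'| >= |n P - z P'| + n m / k^(n-1): u = z P'/(n P) is
   an average of the points z/(z - a), a a root, which all lie in the disc
   |u - 1| <= k |u|; the term with m comes from applying this to
   P + lam m (z/k)^n, |lam| < 1. Consequently |D_alpha P| >= (|alpha| - k) |P'|,
   and n (P + beta m / k^(n-1)) = z P' (1 + k Om(1/z)), where Om is analytic in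
   the closed unit disc (if k < 1), Om(0) = 0 and |Om| <= 1. Littlewood
   subordination bounds the L^(pr) norm of 1 + k Om by that of 1 + k z, and
   Hoelder's inequality concludes; k = 1 follows by applying this to P(rho z)
   and letting rho decrease to 1.

   Analytic functions are replaced by uniform limits of polynomials on the
   closed disc. Subordination reduces to H^2 by writing |1 + k z|^s as the limit of
   |g(z)|^2 for polynomials g, and there it follows coefficient by coefficient
   from Parseval. *)
Require Import Defs.
From mathcomp Require Import ring lra.

Import Order.TTheory GRing.Theory Num.Theory.
Import numFieldNormedType.Exports.
Local Open Scope classical_set_scope.
Local Open Scope ring_scope.
Local Open Scope complex_scope.

Local Notation Re := (@complex.Re _).
Local Notation Im := (@complex.Im _).

Set Implicit Arguments.
Unset Strict Implicit.
Unset Printing Implicit Defensive.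

(** * Complex moduli and integrals over the circle *)

(** The zeros of [P'] lie in |z| <= k, so the quotient to be subordinated is analytic outside that
    disc. It becomes a function on the unit disc only through w = 1/z, which is why [expi (- t)]
    runs through the integrals. The exponent s = p r is an arbitrary positive real, possibly below
    1. H^2 still suffices because 1 + k z has no zero in the disc, so |1 + k z|^(s/2) is itself the
    modulus of an analytic function. The strict inequality k < 1 enters twice: [P'] does not vanish
    on the unit circle, and |1 + k z| >= 1 - k makes the Taylor series of log (1 + k z) converge
    uniformly. All estimates compare logarithms of moduli, so no branch of a complex logarithm is
    ever chosen; the price is that errors appear as factors [expR e]. *)

Lemma normcX (R : rcfType) (z : R[i]) n : normc (z ^+ n) = normc z ^+ n.
Proof.
elim: n => [|n IH]; first by rewrite !expr0 ComplexField.Normc.normc1.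
by rewrite !exprS ComplexField.Normc.normcM IH.
Qed.

Lemma normc_ge0 (R : rcfType) (z : R[i]) : 0 <= normc z.
Proof. by case: z => a b; exact: sqrtr_ge0. Qed.

Lemma normc_eq0 (R : rcfType) (z : R[i]) : (normc z == 0) = (z == 0).
Proof.
apply/eqP/eqP => [|->]; first exact: ComplexField.Normc.eq0_normc.
exact: ComplexField.Normc.normc0.
Qed.

Lemma normc_gt0 (R : rcfType) (z : R[i]) : (0 < normc z) = (z != 0).
Proof. by rewrite lt_def normc_ge0 andbT normc_eq0. Qed.

Lemma normcR (R : rcfType) (x : R) : normc x%:C = `|x|.
Proof. by rewrite /= expr0n addr0 sqrtr_sqr. Qed.

Lemma normc_sqr (R : rcfType) (z : R[i]) :
  normc z ^+ 2 = Re z ^+ 2 + Im z ^+ 2.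
Proof. by case: z => a b /=; rewrite sqr_sqrtr // addr_ge0 ?sqr_ge0. Qed.

Lemma normr_Re_le (R : rcfType) (z : R[i]) : `|Re z| <= normc z.
Proof.
rewrite -(@ler_pXn2r _ 2) ?nnegrE ?normc_ge0 //.
by rewrite normc_sqr real_normK ?num_real // lerDl sqr_ge0.
Qed.

Lemma normc_le_normD (R : rcfType) (x y : R[i]) :
  normc (x + y) <= normc x + normc y.
Proof. exact: le_normcD. Qed.

Lemma normc_opp (R : rcfType) (x : R[i]) : normc (- x) = normc x.
Proof. exact: normcN. Qed.

Lemma normc_distC (R : rcfType) (x y : R[i]) : normc (x - y) = normc (y - x).
Proof. by rewrite -normc_opp opprB. Qed.

Lemma normc_leB (R : rcfType) (x y : R[i]) :
  normc x - normc y <= normc (x - y).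
Proof.
by rewrite lerBlDr (le_trans _ (normc_le_normD _ _)) // subrK.
Qed.

Lemma normc_expi (R : realType) (t : R) : normc (expi t) = 1.
Proof. by rewrite /= cos2Dsin2 sqrtr1. Qed.

Lemma expiN (R : realType) (t : R) : expi (- t) = conjc (expi t).
Proof. by rewrite /expi cosN sinN. Qed.

Lemma expi_exp (R : realType) (t : R) n :
  expi t ^+ n = cos (n%:R * t) +i* sin (n%:R * t).
Proof.
elim: n => [|n IH]; first by rewrite expr0 mul0r cos0 sin0.
rewrite exprS IH -natr1 mulrDl mul1r cosD sinD.
apply/eqP; rewrite eq_complex /=; apply/andP; split; apply/eqP; ring.
Qed.

(** * Continuity of complex-valued functions of a real variable *)

Definition ccontinuous (R : realType) (f : R -> R[i]) : Prop :=
  continuous (fun t => Re (f t) : R) /\ continuous (fun t => Im (f t) : R).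

Lemma ccontinuous_cst (R : realType) (c : R[i]) :
  ccontinuous (fun _ : R => c).
Proof. by split; move=> t; exact: cvg_cst. Qed.

Lemma ccontinuousD (R : realType) (f g : R -> R[i]) :
  ccontinuous f -> ccontinuous g -> ccontinuous (fun t => f t + g t).
Proof.
move=> [f1 f2] [g1 g2]; split; move=> t.
- rewrite (_ : (fun u => _) = (fun u => Re (f u) + Re (g u))).
    by apply: cvgD; [exact: f1|exact: g1].
  by apply/funext => u; case: (f u) (g u) => a b [c d].
- rewrite (_ : (fun u => _) = (fun u => Im (f u) + Im (g u))).
    by apply: cvgD; [exact: f2|exact: g2].
  by apply/funext => u; case: (f u) (g u) => a b [c d].
Qed.

Lemma ccontinuousM (R : realType) (f g : R -> R[i]) :
  ccontinuous f -> ccontinuous g -> ccontinuous (fun t => f t * g t).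
Proof.
move=> [f1 f2] [g1 g2]; split; move=> t.
- rewrite (_ : (fun u => _) =
    (fun u => Re (f u) * Re (g u) - Im (f u) * Im (g u))).
    apply: cvgB; apply: cvgM;
      [exact: f1|exact: g1|exact: f2|exact: g2].
  by apply/funext => u; case: (f u) (g u) => a b [c d].
- rewrite (_ : (fun u => _) =
    (fun u => Re (f u) * Im (g u) + Im (f u) * Re (g u))).
    apply: cvgD; apply: cvgM;
      [exact: f1|exact: g2|exact: f2|exact: g1].
  by apply/funext => u; case: (f u) (g u) => a b [c d].
Qed.

Lemma ccontinuous_expi (R : realType) : ccontinuous (@expi R).
Proof. by split; [exact: continuous_cos|exact: continuous_sin]. Qed.

Lemma ccontinuous_expiN (R : realType) : ccontinuous (fun t : R => expi (- t)).
Proof.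
split=> /= t.
- rewrite (_ : (fun u => _) = cos); first exact: continuous_cos.
  by apply/funext => u; rewrite cosN.
- rewrite (_ : (fun u => _) = fun u => - sin u).
    by apply: cvgN; exact: continuous_sin.
  by apply/funext => u; rewrite sinN.
Qed.

Lemma ccontinuous_horner (R : realType) (p : {poly R[i]}) (f : R -> R[i]) :
  ccontinuous f -> ccontinuous (fun t => p.[f t]).
Proof.
move=> cf; elim/poly_ind: p => [|p c IH].
  rewrite (_ : (fun t => _) = fun _ : R => 0).
    exact: ccontinuous_cst.
  by apply/funext => t; rewrite horner0.
rewrite (_ : (fun t => _) = fun t => p.[f t] * f t + c).
  apply: ccontinuousD; last exact: ccontinuous_cst.
  exact: ccontinuousM.
by apply/funext => t; rewrite hornerMXaddC.
Qed.

Lemma continuous_normc (R : realType) (f : R -> R[i]) :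
  ccontinuous f -> continuous (fun t => normc (f t) : R).
Proof.
move=> [f1 f2] t.
rewrite (_ : (fun u => _) =
  (fun u => Num.sqrt (Re (f u) * Re (f u) + Im (f u) * Im (f u)))).
  apply: continuous_comp; last exact: sqrt_continuous.
  by apply: cvgD; apply: cvgM; [exact: f1|exact: f1|exact: f2|exact: f2].
by apply/funext => u; case: (f u) => a b /=; rewrite -!expr2.
Qed.

Lemma continuous_at_powR_ge0 (R : realType) (f : R -> R) (s t : R) :
  0 < s -> (forall t, 0 <= f t) -> {for t, continuous f} ->
  {for t, continuous (fun t => f t `^ s)}.
Proof.
move=> s0 f0 cf.
have [ft0|ft0] := eqVneq (f t) 0.
  rewrite /prop_for /continuous_at /= ft0 powR0 ?gt_eqF //.
  apply/cvgrPdist_lt => e e0; near=> u.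
  rewrite sub0r normrN ger0_norm ?powR_ge0 //.
  have fu : f u < e `^ s^-1.
    near: u; have := cf => /cvgrPdist_lt /(_ (e `^ s^-1)).
    rewrite powR_gt0 // => /(_ isT); apply: filterS => u.
    by rewrite ft0 sub0r normrN ger0_norm.
  rewrite -[ltRHS](powRr1 (ltW e0)) -(mulVf (lt0r_neq0 s0)) powRrM.
  by apply: gt0_ltr_powR; rewrite ?nnegrE ?powR_ge0.
have fp : 0 < f t by rewrite lt_def ft0 f0.
apply: (@continuous_comp _ _ _ f (fun x => x `^ s)); first exact: cf.
apply/differentiable_continuous/derivable1_diffP/derivable_powR.
by rewrite in_itv /= fp.
Unshelve. all: by end_near.
Qed.

Lemma continuous_powR_ge0 (R : realType) (f : R -> R) (s : R) :
  0 < s -> (forall t, 0 <= f t) -> continuous f ->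
  continuous (fun t => f t `^ s).
Proof. by move=> s0 f0 cf t; exact/continuous_at_powR_ge0/cf. Qed.

(** * Integrals of continuous functions over [0, 2 pi] *)

Definition icirc (R : realType) (f : R -> R) : R :=
  \int[@lebesgue_measure R]_(t in `[0, 2 * pi]) f t.

Lemma icirc_integrable (R : realType) (f : R -> R) : continuous f ->
  (@lebesgue_measure R).-integrable `[0, 2 * pi] (EFin \o f).
Proof.
move=> cf; apply: continuous_compact_integrable; first exact: segment_compact.
exact: continuous_subspaceT.
Qed.

Lemma icircD (R : realType) (f g : R -> R) : continuous f -> continuous g ->
  icirc (fun t => f t + g t) = icirc f + icirc g.
Proof. by move=> cf cg; apply: RintegralD => //; exact: icirc_integrable. Qed.

Lemma icircZ (R : realType) (a : R) (f : R -> R) : continuous f ->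
  icirc (fun t => a * f t) = a * icirc f.
Proof. by move=> cf; apply: RintegralZl => //; exact: icirc_integrable. Qed.

Lemma le_icirc (R : realType) (f g : R -> R) : continuous f -> continuous g ->
  (forall t, f t <= g t) -> icirc f <= icirc g.
Proof.
by move=> cf cg fg; apply: le_Rintegral => //; exact: icirc_integrable.
Qed.

Lemma icirc_cst (R : realType) (a : R) : icirc (fun=> a) = 2 * pi * a.
Proof.
rewrite /icirc Rintegral_cst //= lebesgue_measure_itv /= lte_fin.
by rewrite mulr_gt0 ?pi_gt0 //= oppr0 addr0 mulrC.
Qed.

Lemma icirc_ge0 (R : realType) (f : R -> R) : (forall t, 0 <= f t) ->
  0 <= icirc f.
Proof. by move=> f0; apply: Rintegral_ge0 => t _. Qed.

Lemma icirc_gt0 (R : realType) (f : R -> R) : continuous f ->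
  (forall t, 0 < f t) -> 0 < icirc f.
Proof.
move=> cf f0.
have p0 : (0 : R) <= 2 * pi by rewrite mulr_ge0 ?pi_ge0.
have [c _ minc] := @EVT_min R f _ _ p0 (continuous_subspaceT cf).
apply: (@lt_le_trans _ _ (icirc (fun=> f c))).
  by rewrite icirc_cst mulr_gt0 // mulr_gt0 ?pi_gt0.
apply: le_Rintegral => //.
  by apply: icirc_integrable => t; exact: cvg_cst.
exact: icirc_integrable.
Qed.

Lemma icirc_eq0 (R : realType) (f F : R -> R) : continuous f ->
  (forall t : R, is_derive t 1 F (f t)) -> F (2 * pi) = F 0 -> icirc f = 0.
Proof.
move=> cf dF F2; rewrite /icirc /Rintegral.
have cF : continuous F.
  move=> t; apply/differentiable_continuous/derivable1_diffP.
  by case: (dF t).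
rewrite (@continuous_FTC2 _ _ F) ?F2 ?subee //.
- by rewrite mulr_gt0 ?pi_gt0.
- exact: continuous_subspaceT.
- split.
  + by move=> t _; case: (dF t).
  + exact/cvg_at_right_filter/cF.
  + exact/cvg_at_left_filter/cF.
- by move=> t _; rewrite derive1E; case: (dF t).
Qed.

(** * Parseval, Littlewood's inequality in H^2, and the maximum principle *)

(** Mean value property: the factor [expi t] removes the constant term, and every remaining monomial
    has a periodic primitive. *)
Lemma icirc_Re_horner_mulX (R : realType) (p : {poly R[i]}) :
  icirc (fun t => Re (p.[expi t] * expi t)) = 0.
Proof.
(* Induction on the number of coefficients keeps the powers of [expi t] fixed; [poly_ind] would
   shift them. *)
pose F n t : R := Re (\sum_(i < n) p`_i * expi t ^+ i.+1).
suff HF n : continuous (F n) /\ icirc (F n) = 0.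
  rewrite -[RHS](HF (size p)).2; congr icirc; apply/funext => t.
  rewrite horner_coef mulr_suml; congr Re; apply: eq_bigr => i _.
  by rewrite exprSr mulrA.
elim: n => [|n [cF IH]].
  rewrite (_ : F 0%N = fun=> 0); last by apply/funext => t; rewrite /F big_ord0.
  by rewrite icirc_cst mulr0; split => // t; exact: cvg_cst.
set a := Re p`_n; set b := Im p`_n.
pose f (t : R) : R := a * cos (n.+1%:R * t) - b * sin (n.+1%:R * t).
have FE : F n.+1 = fun t => F n t + f t.
  apply/funext => t; rewrite /F /f big_ord_recr /= expi_exp /a /b.
  by case: (\sum_(i < n) _) p`_n => x y [u v].
have cl : continuous (fun t : R => n.+1%:R * t).
  by move=> t; apply: cvgM; [exact: cvg_cst|exact: cvg_id].
have cf : continuous f.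
  move=> t; apply: cvgB; (apply: cvgM; first exact: cvg_cst).
    by apply: (@continuous_comp _ _ _ _ cos); [exact: cl|exact: continuous_cos].
  by apply: (@continuous_comp _ _ _ _ sin); [exact: cl|exact: continuous_sin].
split; first by rewrite FE => t; apply: cvgD; [exact: cF|exact: cf].
rewrite FE icircD // IH add0r.
apply: (@icirc_eq0 _ _ (fun t : R =>
  n.+1%:R^-1 * (a * sin (n.+1%:R * t) + b * cos (n.+1%:R * t)))) => //.
  move=> t; rewrite /f.
  apply: trigger_derive.
  rewrite /GRing.scale /=.
  have n0 : (n.+1%:R : R) != 0 by rewrite pnatr_eq0.
  by field.
have [c2 s2] : cos (n.+1%:R * (2 * pi)) = 1 :> R /\
               sin (n.+1%:R * (2 * pi)) = 0 :> R.
  have := expi_exp (2 * pi : R) n.+1.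
  by rewrite /expi mulr_natl cos2pi sin2pi expr1n => -[<- <-].
by rewrite c2 s2 !mulr0 cos0 sin0 mulr0.
Qed.

Lemma horner_conj (R : rcfType) (p : {poly R[i]}) (z : R[i]) :
  p.[conjc z] = conjc (map_poly conjc p).[z].
Proof.
rewrite -horner_map /=; congr (_.[_]).
by apply/polyP => i; rewrite !coef_map /= conjcK.
Qed.

Lemma icirc_Re_horner_mulX_expiN (R : realType) (p : {poly R[i]}) :
  icirc (fun t => Re (p.[expi (- t)] * expi (- t))) = 0.
Proof.
rewrite -[RHS](icirc_Re_horner_mulX (map_poly conjc p)); congr icirc.
apply/funext => t; rewrite expiN horner_conj -rmorphM /=.
by case: (_ * _).
Qed.

(* Cross terms have mean zero: this is Parseval, one coefficient at a time. *)
Lemma icirc_sqr_MXaddC (R : realType) (e : R -> R[i]) (p : {poly R[i]}) c :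
  ccontinuous e -> (forall t, normc (e t) = 1) ->
  (forall q : {poly R[i]}, icirc (fun t => Re (q.[e t] * e t)) = 0) ->
  icirc (fun t => normc (p * 'X + c%:P).[e t] ^+ 2) =
  icirc (fun t => normc p.[e t] ^+ 2) + 2 * pi * normc c ^+ 2.
Proof.
move=> ce e1 e0.
have cn q : continuous (fun t => normc q.[e t] ^+ 2).
  have cq : continuous (fun t => normc q.[e t] : R).
    exact/continuous_normc/ccontinuous_horner.
  by move=> t; apply: cvgM; exact: cq.
have cr (q : {poly R[i]}) : continuous (fun t => Re (q.[e t] * e t) : R).
  by have [] := ccontinuousM (ccontinuous_horner q ce) ce.
have E t : normc (p * 'X + c%:P).[e t] ^+ 2 =
    (normc p.[e t] ^+ 2 + normc c ^+ 2) +
    2 * Re ((c^* *: p).[e t] * e t).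
  rewrite hornerMXaddC hornerZ !normc_sqr.
  have := e1 t; move/(congr1 (fun x => x ^+ 2)); rewrite normc_sqr expr1n.
  case: (e t) (p.[e t]) c => x y [u v] [a b] /= xy.
  have -> : u ^+ 2 + v ^+ 2 = (x ^+ 2 + y ^+ 2) * (u ^+ 2 + v ^+ 2).
    by rewrite xy mul1r.
  ring.
rewrite (funext E).
have cc : continuous (fun t => normc p.[e t] ^+ 2 + normc c ^+ 2).
  by move=> t; apply: cvgD; [exact: cn|exact: cvg_cst].
rewrite icircD //; last first.
  by move=> t; apply: cvgM; [exact: cvg_cst|exact: cr].
rewrite (icircZ 2) ?e0 ?mulr0 ?addr0; last exact: cr.
by rewrite icircD ?icirc_cst // => t; exact: cvg_cst.
Qed.

Definition sqnorm2 (R : realType) (p : {poly R[i]}) : R :=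
  icirc (fun t => normc p.[expi t] ^+ 2).

Lemma sqnorm2_MXaddC (R : realType) (p : {poly R[i]}) c :
  sqnorm2 (p * 'X + c%:P) = sqnorm2 p + 2 * pi * normc c ^+ 2.
Proof.
apply: icirc_sqr_MXaddC; first exact: ccontinuous_expi.
  exact: normc_expi.
exact: icirc_Re_horner_mulX.
Qed.

(** Both sides satisfy the same Parseval recursion on the coefficients, which replaces a change of
    variable in the integral. *)
Lemma sqnorm2_expiN (R : realType) (p : {poly R[i]}) :
  icirc (fun t => normc p.[expi (- t)] ^+ 2) = sqnorm2 p.
Proof.
elim/poly_ind: p => [|p c IH].
  by rewrite /sqnorm2; congr icirc; apply/funext => t; rewrite !horner0.
rewrite sqnorm2_MXaddC -IH; apply: icirc_sqr_MXaddC.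
- exact: ccontinuous_expiN.
- by move=> t; rewrite normc_expi.
- exact: icirc_Re_horner_mulX_expiN.
Qed.

Lemma continuous_sqnormc_horner (R : realType) (p : {poly R[i]}) :
  continuous (fun t : R => normc p.[expi t] ^+ 2).
Proof.
have cq : continuous (fun t : R => normc p.[expi t] : R).
  exact/continuous_normc/ccontinuous_horner/ccontinuous_expi.
by move=> t; apply: cvgM; exact: cq.
Qed.

Lemma le_sqnorm2 (R : realType) (p q : {poly R[i]}) :
  (forall t : R, normc p.[expi t] <= normc q.[expi t]) ->
  sqnorm2 p <= sqnorm2 q.
Proof.
move=> pq; apply: le_icirc; [exact: continuous_sqnormc_horner..|move=> t].
by rewrite ler_pXn2r ?nnegrE ?normc_ge0.
Qed.

(* Littlewood's subordination principle in the Hardy space H^2. *)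
Lemma sqnorm2_comp_le (R : realType) (g W : {poly R[i]}) :
  W.[0] = 0 -> (forall t : R, normc W.[expi t] <= 1) ->
  sqnorm2 (g \Po W) <= sqnorm2 g.
Proof.
move=> W0 W1.
have [V VE] : exists V, W = V * 'X.
  have /factor_theorem[V] : root W 0 by rewrite rootE W0.
  by rewrite subr0 => ->; exists V.
elim/poly_ind: g => [|g c IH]; first by rewrite comp_poly0.
(* With [W = V * 'X] the composite is again of the form [_ * 'X + c%:P], so Parseval splits off [c];
   the factor [V] costs nothing since |V| = |W| <= 1 on the circle. *)
rewrite comp_poly_MXaddC [in X in _ * X]VE mulrA !sqnorm2_MXaddC lerD2r.
apply: le_trans IH; apply: le_sqnorm2 => t.
rewrite hornerM ComplexField.Normc.normcM ler_piMr ?normc_ge0 //.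
have := W1 t; rewrite VE hornerM hornerX ComplexField.Normc.normcM.
by rewrite normc_expi mulr1.
Qed.

(** By Parseval, 2 pi times the squared modulus of one coefficient is at most [sqnorm2 p], hence at
    most 2 pi [mu ^+ 2]. *)
Lemma normc_coef_le (R : realType) (p : {poly R[i]}) (mu : R) :
  (forall t : R, normc p.[expi t] <= mu) -> forall j, normc p`_j <= mu.
Proof.
move=> pmu j.
have mu0 : 0 <= mu := le_trans (normc_ge0 _) (pmu 0).
have pi20 : 0 < 2 * pi :> R by rewrite mulr_gt0 ?pi_gt0.
rewrite -(@ler_pXn2r _ 2) ?nnegrE ?normc_ge0 // -(ler_pM2l pi20).
apply: (@le_trans _ _ (sqnorm2 p)); last first.
  rewrite -icirc_cst; apply: le_icirc => [||t].
  - exact: continuous_sqnormc_horner.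
  - by move=> t; exact: cvg_cst.
  - by rewrite ler_pXn2r ?nnegrE ?normc_ge0.
elim/poly_ind: p j {pmu} => [|p c IH] j.
  rewrite coef0 ComplexField.Normc.normc0 expr0n mulr0.
  by apply: icirc_ge0 => t; exact: sqr_ge0.
rewrite sqnorm2_MXaddC coefD coefMX coefC; case: j => [|j] /=.
  by rewrite add0r lerDr; apply: icirc_ge0 => t; exact: sqr_ge0.
by rewrite addr0 (le_trans (IH j)) // lerDl mulr_ge0 ?sqr_ge0 // ltW.
Qed.

Lemma exprn_lt_eps (R : realType) (a e : R) : 0 <= a -> a < 1 -> 0 < e ->
  exists N, a ^+ N < e.
Proof.
move=> a0 a1 e0.
have na : `|a| < 1 by rewrite ger0_norm.
have /cvgrPdist_lt /(_ e e0) [N _ /(_ N (leqnn N))] := cvg_geometric 1 na.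
by rewrite /= sub0r normrN mul1r ger0_norm ?exprn_ge0 // => ?; exists N.
Qed.

(* The coefficient bound, applied to all powers of p (Landau's trick). *)
Lemma max_modulus_poly (R : realType) (p : {poly R[i]}) (mu : R) w :
  (forall t : R, normc p.[expi t] <= mu) -> normc w < 1 ->
  normc p.[w] <= mu.
Proof.
move=> pmu w1.
have mu0 : 0 <= mu := le_trans (normc_ge0 _) (pmu 0).
have coef_bound (q : {poly R[i]}) nu : (forall j, normc q`_j <= nu) ->
    normc q.[w] * (1 - normc w) <= nu.
  elim/poly_ind: q => [|q c IH] H.
    rewrite horner0 ComplexField.Normc.normc0 mul0r.
    exact: le_trans (normc_ge0 _) (H 0%N).
  have {}IH : normc q.[w] * (1 - normc w) <= nu.
    apply: IH => j; have := H j.+1.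
    by rewrite coefD coefMX coefC /= addr0.
  have cn : normc c <= nu.
    by have := H 0%N; rewrite coefD coefMX coefC /= add0r.
  have := normc_le_normD (q.[w] * w) c.
  rewrite hornerMXaddC ComplexField.Normc.normcM.
  have := normc_ge0 w; move: IH w1 cn; set a := normc w; set Q := normc _.
  set S := normc (_ + _); set C := normc c => H1 H2 H3 H4 H5.
  have : S * (1 - a) <= (Q * a + C) * (1 - a).
    by rewrite ler_wpM2r // subr_ge0 ltW.
  have := ler_wpM2l H4 H1.
  have : C * (1 - a) <= nu * (1 - a) by rewrite ler_wpM2r // subr_ge0 ltW.
  lra.
rewrite leNgt; apply/negP => mux.
have x0 : 0 < normc p.[w] := le_lt_trans mu0 mux.
(* [coef_bound] loses the factor 1 - |w|. For [p ^+ N] it reads |p(w)|^N (1 - |w|) <= mu^N, which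
   fails for large [N] if mu < |p(w)|. *)
have [N] : exists N, (mu / normc p.[w]) ^+ N < 1 - normc w.
  apply: exprn_lt_eps; rewrite ?subr_gt0 ?divr_ge0 ?normc_ge0 //.
  by rewrite ltr_pdivrMr // mul1r.
rewrite expr_div_n ltr_pdivrMr ?exprn_gt0 // ltNge mulrC => /negP; apply.
rewrite -normcX -horner_exp; apply/coef_bound/normc_coef_le => t.
by rewrite horner_exp normcX lerXn2r ?nnegrE ?normc_ge0.
Qed.

(** * The disc algebra: uniform limits of polynomials on the closed unit disc *)

Definition disc_approx (R : realType) (f : R[i] -> R[i]) : Prop :=
  forall e, 0 < e -> exists p : {poly R[i]},
    forall w, normc w <= 1 -> normc (f w - p.[w]) <= e.

Lemma disc_approx_horner (R : realType) (p : {poly R[i]}) :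
  disc_approx (horner p).
Proof.
by move=> e e0; exists p => w _; rewrite subrr ComplexField.Normc.normc0 ltW.
Qed.

Lemma horner_disc_bounded (R : realType) (p : {poly R[i]}) :
  exists2 M : R, 0 < M & forall w, normc w <= 1 -> normc p.[w] <= M.
Proof.
elim/poly_ind: p => [|p c [M M0 HM]].
  by exists 1 => // w _; rewrite horner0 ComplexField.Normc.normc0.
exists (M + normc c) => [|w w1]; first by rewrite ltr_wpDr ?normc_ge0.
rewrite hornerMXaddC (le_trans (normc_le_normD _ _)) // lerD2r.
rewrite ComplexField.Normc.normcM -[leRHS]mulr1.
by rewrite ler_pM ?normc_ge0 ?HM.
Qed.

Lemma disc_approx_bounded (R : realType) (f : R[i] -> R[i]) : disc_approx f ->
  exists2 M : R, 0 < M & forall w, normc w <= 1 -> normc (f w) <= M.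
Proof.
move=> /(_ 1 ltr01)[p pf]; have [M M0 HM] := horner_disc_bounded p.
exists (1 + M) => [|w w1]; first by rewrite addr_gt0.
by rewrite -(subrK p.[w] (f w)) (le_trans (normc_le_normD _ _)) // lerD ?pf ?HM.
Qed.

Lemma disc_approxM (R : realType) (f g : R[i] -> R[i]) :
  disc_approx f -> disc_approx g -> disc_approx (fun w => f w * g w).
Proof.
move=> af ag e e0; have e2 : 0 < e / 2 by rewrite divr_gt0.
have [M M0 HM] := disc_approx_bounded ag.
have [p pf] := af (e / 2 / M) (divr_gt0 e2 M0).
have [L L0 HL] := horner_disc_bounded p.
have [q qg] := ag (e / 2 / L) (divr_gt0 e2 L0).
exists (p * q) => w w1.
have -> : f w * g w - (p * q).[w] =
    (f w - p.[w]) * g w + p.[w] * (g w - q.[w]) by rewrite hornerM; ring.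
rewrite (le_trans (normc_le_normD _ _)) // !ComplexField.Normc.normcM.
have -> : e = e / 2 / M * M + L * (e / 2 / L).
  by field; rewrite !gt_eqF.
by rewrite lerD // ler_pM ?normc_ge0 ?pf ?HM ?HL ?qg.
Qed.

Lemma disc_approx_ext (R : realType) (f g : R[i] -> R[i]) :
  (forall w, normc w <= 1 -> f w = g w) -> disc_approx f -> disc_approx g.
Proof.
by move=> fg af e /af[p pf]; exists p => w w1; rewrite -fg // pf.
Qed.

Lemma disc_approx_invXsubC (R : realType) (a : R[i]) : 1 < normc a ->
  disc_approx (fun w => (w - a)^-1).
Proof.
move=> a1 e e0.
have ap : 0 < normc a := lt_trans ltr01 a1.
have a0 : a != 0 by rewrite -normc_gt0.
(* The error of the truncated geometric series is (w/a)^N / (w - a), and |w - a| >= |a| - 1. *)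
have [N HN] : exists N, (normc a)^-1 ^+ N < e * (normc a - 1).
  apply: exprn_lt_eps; rewrite ?invr_ge0 ?normc_ge0 ?invf_lt1 //.
  by rewrite mulr_gt0 // subr_gt0.
pose S : {poly R[i]} := \sum_(i < N) (a^-1 *: 'X) ^+ i.
exists (- (a^-1 *: S)) => w w1.
have wa : w - a != 0.
  rewrite -normc_gt0 normc_distC (lt_le_trans _ (normc_leB _ _)) //.
  by rewrite subr_gt0 (le_lt_trans w1).
have SE : (w / a) ^+ N - 1 = (w / a - 1) * S.[w].
  rewrite subrX1 horner_sum; congr (_ * _); apply: eq_bigr => i _.
  by rewrite hornerE hornerE hornerX mulrC.
have -> : (w - a)^-1 - (- (a^-1 *: S)).[w] = (w / a) ^+ N / (w - a).
  rewrite -[(w / a) ^+ N](subrK 1) SE hornerN hornerZ.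
  by field; rewrite wa a0.
rewrite ComplexField.Normc.normcM normcX ComplexField.Normc.normcM.
rewrite !ComplexField.Normc.normcV ler_pdivrMr ?normc_gt0 //.
apply: (@le_trans _ _ (e * (normc a - 1))).
  rewrite (le_trans _ (ltW HN)) // lerXn2r ?nnegrE //.
  - by rewrite divr_ge0 ?normc_ge0.
  - by rewrite invr_ge0 normc_ge0.
  - by rewrite ler_piMl ?invr_ge0 ?normc_ge0.
rewrite ler_pM2l // normc_distC (le_trans _ (normc_leB _ _)) //.
by rewrite lerB.
Qed.

(** All roots of [B] lie outside the closed disc, so 1/B is a constant times a product of simple
    fractions, each a convergent geometric series. *)
Lemma disc_approx_inv (R : realType) (B : {poly R[i]}) :
  (forall w, normc w <= 1 -> B.[w] != 0) -> disc_approx (fun w => B.[w]^-1).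
Proof.
move=> B0; have [s BE] := closed_field_poly_normal B.
have lB : lead_coef B != 0.
  rewrite lead_coef_eq0; apply: contra_neq (B0 0 _) => [->|].
    by rewrite horner0.
  by rewrite ComplexField.Normc.normc0.
have s1 a : a \in s -> 1 < normc a.
  move=> sa; rewrite ltNge; apply/negP => /B0/eqP; apply.
  apply/rootP; rewrite BE rootZ // root_prod_XsubC //.
have prod_inv (r : seq R[i]) : (forall a, a \in r -> 1 < normc a) ->
    disc_approx (fun w => (\prod_(z <- r) ('X - z%:P)).[w]^-1).
  elim: r => [|a r IH] r1.
    apply: disc_approx_ext (disc_approx_horner 1) => w _.
    by rewrite big_nil hornerC invr1.
  apply: (@disc_approx_ext _ (fun w => (w - a)^-1 *
      (\prod_(z <- r) ('X - z%:P)).[w]^-1)) => [w _|].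
    by rewrite big_cons hornerM hornerXsubC invfM.
  apply: disc_approxM; first by apply/disc_approx_invXsubC/r1/mem_head.
  by apply: IH => b br; rewrite r1 // in_cons br orbT.
apply: (@disc_approx_ext _ (fun w => ((lead_coef B)^-1)%:P.[w] *
    (\prod_(z <- s) ('X - z%:P)).[w]^-1)) => [w _|].
  by rewrite [in RHS]BE hornerZ hornerC invfM.
by apply: disc_approxM; [exact: disc_approx_horner|exact: prod_inv].
Qed.

Lemma max_modulus (R : realType) (f : R[i] -> R[i]) (mu : R) w :
  disc_approx f -> (forall t : R, normc (f (expi t)) <= mu) -> normc w < 1 ->
  normc (f w) <= mu.
Proof.
move=> af fmu w1; apply/ler_addgt0Pr => e e0.
have e2 : 0 < e / 2 by rewrite divr_gt0.
have [p pf] := af _ e2.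
have pmu (t : R) : normc p.[expi t] <= mu + e / 2.
  rewrite -(subrK (f (expi t)) p.[expi t]) (le_trans (normc_le_normD _ _)) //.
  by rewrite addrC lerD // normc_distC pf // normc_expi.
rewrite -(subrK p.[w] (f w)) (le_trans (normc_le_normD _ _)) //.
have := max_modulus_poly pmu w1; have := pf w (ltW w1); lra.
Qed.

Lemma min_modulus (R : realType) (B : {poly R[i]}) (m : R) w :
  (forall z, normc z <= 1 -> B.[z] != 0) -> 0 < m ->
  (forall t : R, m <= normc B.[expi t]) -> normc w < 1 ->
  m <= normc B.[w].
Proof.
move=> B0 m0 Bm w1; have Bw : B.[w] != 0 by exact/B0/ltW.
rewrite -lef_pV2 ?posrE ?normc_gt0 //.
rewrite -ComplexField.Normc.normcV.
apply: (@max_modulus _ (fun w => B.[w]^-1) m^-1) => [|t|//].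
  exact: disc_approx_inv.
rewrite ComplexField.Normc.normcV lef_pV2 ?posrE ?normc_gt0 ?Bm //.
by rewrite B0 // normc_expi.
Qed.

(** * Subordination *)

Lemma ReD (R : rcfType) (x y : R[i]) : Re (x + y) = Re x + Re y.
Proof. by case: x y => a b []. Qed.

Lemma ReB (R : rcfType) (x y : R[i]) : Re (x - y) = Re x - Re y.
Proof. by case: x y => a b []. Qed.

Lemma ReZ (R : rcfType) (c : R) (x : R[i]) : Re (c%:C * x) = c * Re x.
Proof. by case: x => a b /=; rewrite mul0r subr0. Qed.

Lemma normc_1kz_ge (R : rcfType) (k : R) (z : R[i]) :
  0 <= k -> normc z <= 1 -> 1 - k <= normc (1 + k%:C * z).
Proof.
move=> k0 z1.
rewrite -(opprK (k%:C * z)) (le_trans _ (normc_leB _ _)) //.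
rewrite ComplexField.Normc.normc1 lerD2l lerN2 normc_opp.
rewrite ComplexField.Normc.normcM normcR ger0_norm // -[leRHS]mulr1.
by rewrite ler_pM ?normc_ge0.
Qed.

(** * Approximation of |1 + k z|^s by |g(z)|^2 *)

Definition log1p_poly (R : realType) (k : R) (N : nat) : {poly R[i]} :=
  \sum_(j < N) ((-1) ^+ j * k ^+ j.+1 / j.+1%:R)%:C *: 'X^(j.+1).

Lemma Re_divc (R : rcfType) (z u : R[i]) :
  Re (z / u) = (Re z * Re u + Im z * Im u) / (Re u ^+ 2 + Im u ^+ 2).
Proof. by case: z u => x y [a b] /=; ring. Qed.

(** For fixed z, replace k by a real variable c in [0, k]. Both functions vanish at c = 0, and their
    derivatives 2 Re (z / (1 + c z)) and 2 Re (z S), with S a partial geometric sum, differ by a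
    geometric tail; the mean value theorem concludes. *)
Lemma log1p_poly_approx (R : realType) (k : R) (N : nat) (z : R[i]) :
  0 < k -> k < 1 -> normc z <= 1 ->
  `|ln (normc (1 + k%:C * z) ^+ 2) - 2 * Re (log1p_poly k N).[z]|
    <= 2 * k ^+ N / (1 - k).
Proof.
move=> k0 k1 z1; set x := Re z; set y := Im z.
(* [q] is |1 + c z|^2 and [L] twice the real part of the Taylor sum, as real polynomials in c, so
   that both can be differentiated formally. *)
pose q : {poly R} := (1 + x *: 'X) ^+ 2 + (y *: 'X) ^+ 2.
pose L : {poly R} :=
  \sum_(j < N) (2 * (-1) ^+ j * Re (z ^+ j.+1) / j.+1%:R) *: 'X^(j.+1).
have qE c : q.[c] = normc (1 + c%:C * z) ^+ 2.
  rewrite normc_sqr /q !hornerE /x /y.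
  by case: z {z1 x y q L} => x y /=; ring.
have LE : L.[k] = 2 * Re (log1p_poly k N).[z].
  rewrite /L /log1p_poly !horner_sum.
  rewrite (big_morph (@complex.Re R) (@ReD R) (erefl : Re 0 = 0 :> R)).
  rewrite mulr_sumr; apply: eq_bigr => j _.
  rewrite !hornerZ !hornerXn ReZ; field.
  by rewrite nat1r pnatr_eq0.
have u_lb c : 0 <= c <= k -> 1 - k <= normc (1 + c%:C * z).
  move=> /andP[c0 ck]; apply: le_trans (normc_1kz_ge c0 z1).
  by rewrite lerD2l lerN2.
have q0 c : 0 <= c <= k -> 0 < q.[c].
  move=> /u_lb uc; rewrite qE exprn_gt0 // (lt_le_trans _ uc) //.
  by rewrite subr_gt0.
pose f (t : R) := ln q.[t] - L.[t].
have df (t : R) : 0 <= t <= k ->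
    is_derive t 1 f (q^`().[t] / q.[t] - L^`().[t]).
  move=> /q0 qt; apply: is_deriveB.
  apply: (@trigger_derive _ _ _ ((q.[t])^-1 * q^`().[t])); last exact: mulrC.
  by apply: is_derive1_comp; exact: is_derive1_ln.
have df_le c : 0 <= c <= k ->
    `|q^`().[c] / q.[c] - L^`().[c]| <= 2 * k ^+ N / (1 - k).
  move=> ck; have uk := u_lb c ck; set u := 1 + c%:C * z in uk.
  have u0 : u != 0.
    by rewrite -normc_gt0 (lt_le_trans _ uk) // subr_gt0.
  have -> : q^`().[c] / q.[c] = 2 * Re (z / u).
    rewrite qE Re_divc normc_sqr mulrA; congr (_ / _).
    rewrite /q !poly.derivE !hornerE /u /x /y.
    by case: z {z1 u u0 uk x y q L f df q0 LE qE u_lb} => x y /=; ring.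
  pose S : R[i] := \sum_(j < N) (- (c%:C * z)) ^+ j.
  have -> : L^`().[c] = 2 * Re (z * S).
    rewrite /L /S raddf_sum horner_sum mulr_sumr.
    rewrite (big_morph (@complex.Re R) (@ReD R) (erefl : Re 0 = 0 :> R)).
    rewrite mulr_sumr; apply: eq_bigr => j _.
    rewrite /= derivZ derivXn hornerZ hornerMn hornerXn /=.
    have -> : z * (- (c%:C * z)) ^+ j =
        ((-1) ^+ j * c ^+ j)%:C * z ^+ j.+1.
      rewrite (exprNn (c%:C * z)) (exprMn _ c%:C z) exprS rmorphM !rmorphXn.
      rewrite rmorphN rmorph1 /=; ring.
    rewrite ReZ -mulr_natr; field.
    by rewrite nat1r pnatr_eq0.
  rewrite -mulrBr -ReB normrM ger0_norm // -mulrA ler_pM2l //.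
  rewrite (le_trans (normr_Re_le _)) //.
  have SE : (- (c%:C * z)) ^+ N - 1 = - u * S.
    by rewrite subrX1 /u; congr (_ * _); ring.
  have -> : z / u - z * S = z * (- (c%:C * z)) ^+ N / u.
    by rewrite -[(- _) ^+ N](subrK 1) SE; field.
  rewrite 2!ComplexField.Normc.normcM normcX normc_opp.
  rewrite ComplexField.Normc.normcV ComplexField.Normc.normcM normcR.
  have /andP[c0 ck'] := ck; rewrite ger0_norm //.
  apply: ler_pM; rewrite ?mulr_ge0 ?invr_ge0 ?exprn_ge0 ?mulr_ge0 ?normc_ge0 //.
    rewrite -[leRHS]mul1r ler_pM ?exprn_ge0 ?mulr_ge0 ?normc_ge0 //.
    rewrite lerXn2r ?nnegrE ?mulr_ge0 ?normc_ge0 ?(ltW k0) //.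
    by rewrite -[leRHS]mulr1 ler_pM ?normc_ge0.
  by rewrite lef_pV2 ?posrE ?subr_gt0 // (lt_le_trans _ uk) // subr_gt0.
have [c cI fc] : exists2 c, c \in `[0, k]%R &
    f k - f 0 = (q^`().[c] / q.[c] - L^`().[c]) * (k - 0).
  apply: MVT_segment; first exact: ltW.
    move=> t; rewrite in_itv /= => /andP[t0 tk]; apply: df.
    by rewrite !ltW.
  apply: derivable_within_continuous => t; rewrite in_itv /= => tk.
  by case: (df t tk).
have f0 : f 0 = 0.
  rewrite /f /q /L horner_sum !hornerE expr0n addr0 expr1n ln1 sub0r.
  rewrite big1 ?oppr0 //.
  by move=> j _; rewrite !hornerE expr0n mulr0.
move: fc; rewrite f0 !subr0 /f qE LE => ->.
rewrite normrM (ger0_norm (ltW k0)) -[leRHS]mulr1.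
by apply: ler_pM; rewrite ?normr_ge0 ?(ltW k0) ?(ltW k1) ?df_le //;
  move: cI; rewrite in_itv.
Qed.

(** This is ln (1 + x) <= x at the x with 1 + x = 1 / (1 + y). *)
Lemma ln1p_ge (R : realType) (y : R) : -1 < y -> y / (1 + y) <= ln (1 + y).
Proof.
move=> y1; have y0 : 0 < 1 + y by lra.
have := @le_ln1Dx R (- (y / (1 + y))).
have -> : 1 + - (y / (1 + y)) = (1 + y)^-1 by field; rewrite gt_eqF.
rewrite lnV ?posrE // lerNl opprK; apply.
by rewrite ltrN2 ltr_pdivrMr // mul1r ltrDr.
Qed.

(** Uniform convergence of (1 + v/M)^M to exp v, seen through the logarithm of the squared modulus.
    Since |1 + v/M|^2 = 1 + y with M y = 2 Re v + |v|^2 / M, it suffices that y - 2 y^2 <= ln (1 +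
    y) <= y for |y| < 1/2. *)
Lemma expn_approx (R : realType) (K e : R) : 0 < K -> 0 < e ->
  exists2 M : nat, (0 < M)%N & forall v : R[i], normc v <= K ->
    `|ln (normc ((1 + (M%:R^-1)%:C * v) ^+ M) ^+ 2) - 2 * Re v| <= e
    /\ (1 + (M%:R^-1)%:C * v) ^+ M != 0.
Proof.
(* [A] bounds |M y|, and C / M bounds the final error. The three lower bounds on [M] give 1/M < 1,
   |y| < 1/2 and C / M <= e. *)
move=> K0 e0; pose A := 2 * K + K ^+ 2.
have A0 : 0 < A by rewrite addr_gt0 ?mulr_gt0 ?exprn_gt0.
pose C := K ^+ 2 + 2 * A ^+ 2.
have C0 : 0 < C by rewrite addr_gt0 ?mulr_gt0 ?exprn_gt0.
pose B := Num.max 1 (Num.max (2 * A) (C / e)).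
have [M BM] : exists M : nat, B < M%:R.
  by exists (Num.bound B); rewrite archi_boundP // le_max ler01.
have [M1 [MA MC]] : 1 < M%:R :> R /\ 2 * A < M%:R /\ C / e < M%:R.
  by move: BM; rewrite /B !gt_max => /andP[-> /andP[-> ->]].
have M0 : 0 < M%:R :> R by lra.
exists M; first by rewrite -(ltr0n R).
move=> v vK.
set h := M%:R^-1 : R.
have h0 : 0 < h by rewrite invr_gt0.
have hM : h * M%:R = 1 by rewrite mulVf ?gt_eqF.
pose n2 := normc v ^+ 2; pose r := Re v.
have n2K : 0 <= n2 <= K ^+ 2.
  by rewrite sqr_ge0 lerXn2r ?nnegrE ?normc_ge0 ?(ltW K0).
have rK : `|r| <= K := le_trans (normr_Re_le v) vK.
pose y := h * (2 * r + h * n2).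
have yE : normc (1 + h%:C * v) ^+ 2 = 1 + y.
  rewrite /y /n2 /r !normc_sqr; case: (v) => a b /=; ring.
have h1 : h < 1 by rewrite invf_lt1.
have tA : `|2 * r + h * n2| <= A.
  have hn0 : 0 <= h * n2 by rewrite mulr_ge0 ?(ltW h0) //; lra.
  rewrite (le_trans (ler_normD _ _)) // (ger0_norm hn0) (normrM 2).
  rewrite (ger0_norm (ler0n _ 2)).
  have : h * n2 <= 1 * K ^+ 2 by apply: ler_pM; lra.
  rewrite /A; lra.
have yA : `|y| <= h * A by rewrite normrM (ger0_norm (ltW h0)) ler_pM2l.
have hA : h * A < 1 / 2.
  rewrite -[ltRHS](mulfK (lt0r_neq0 M0)) -/h mulrC ltr_pM2r //; lra.
have y2 : `|y| < 1 / 2 := le_lt_trans yA hA.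
move: (y2); rewrite ltr_norml => /andP[y3 y4].
have y1 : 0 < 1 + y by lra.
have lnM : ln (normc ((1 + h%:C * v) ^+ M) ^+ 2) = M%:R * ln (1 + y).
  by rewrite normcX exprAC yE lnXn // mulr_natl.
split; last first.
  rewrite expf_neq0 // -normc_eq0; apply/eqP => E0.
  by move: y1; rewrite -yE E0 expr0n ltxx.
rewrite lnM.
have My : M%:R * y = 2 * r + h * n2.
  by rewrite /y mulrA [M%:R * h]mulrC hM mul1r.
have up : M%:R * ln (1 + y) <= M%:R * y.
  by rewrite ler_pM2l // le_ln1Dx //; lra.
have lo : M%:R * (y - 2 * y ^+ 2) <= M%:R * ln (1 + y).
  rewrite ler_pM2l // (le_trans _ (ln1p_ge _)) //; last by lra.
  rewrite ler_pdivlMr //.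
  have : 0 <= y ^+ 2 * (1 + 2 * y) by rewrite mulr_ge0 ?sqr_ge0 //; lra.
  lra.
have y2A : M%:R * (2 * y ^+ 2) <= 2 * h * A ^+ 2.
  have : y ^+ 2 <= (h * A) ^+ 2.
    rewrite -[y ^+ 2]real_normK ?num_real // lerXn2r ?nnegrE //.
    by rewrite mulr_ge0 // ltW.
  rewrite -(ler_pM2l M0) => H.
  have : M%:R * (h * A) ^+ 2 = h * A ^+ 2.
    by rewrite exprMn expr2 !mulrA [M%:R * h]mulrC hM mul1r.
  lra.
have hC : h * C <= e.
  by rewrite /h ler_pdivrMl // -ler_pdivrMr //; exact: ltW.
have hn : 0 <= h * n2 <= h * K ^+ 2.
  by rewrite mulr_ge0 ?ler_pM2l ?(ltW h0) //; lra.
have hC' : h * K ^+ 2 + 2 * h * A ^+ 2 <= e by move: hC; rewrite /C; lra.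
have hA2 : 0 <= 2 * h * A ^+ 2.
  by rewrite !mulr_ge0 ?sqr_ge0 // ltW.
have hK2 : 0 <= h * K ^+ 2 by rewrite mulr_ge0 ?sqr_ge0 // ltW.
rewrite -/r ler_norml; apply/andP; split; move: up lo; rewrite mulrBr My; lra.
Qed.

Lemma powR_expR (R : realType) (a s : R) : 0 < a -> a `^ s = expR (s * ln a).
Proof. by move=> a0; rewrite -ln_powR lnK // posrE powR_gt0. Qed.

(* Replaces (1 + k z)^(s/2) by g = (1 + (s/2)/M * L)^M, where L is a Taylor
   polynomial of log (1 + k z), so that no complex powers are needed. *)
Lemma normc_powR_approx (R : realType) (k s e : R) :
  0 < k -> k < 1 -> 0 < s -> 0 < e ->
  exists g : {poly R[i]}, forall z, normc z <= 1 ->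
    `|ln (normc g.[z] ^+ 2) - s * ln (normc (1 + k%:C * z))| <= e /\
    g.[z] != 0.
Proof.
move=> k0 k1 s0 e0.
(* The Taylor error 2 k^N / (1 - k) enters multiplied by s / 2 and must stay below e / 2; the other
   half of [e] is spent on [M]. *)
have [N HN] : exists N, k ^+ N < e * (1 - k) / (2 * s).
  apply: exprn_lt_eps; rewrite ?(ltW k0) //.
  by rewrite divr_gt0 ?mulr_gt0 ?subr_gt0.
pose V := (s / 2)%:C *: log1p_poly k N.
have [K K0 VK] := horner_disc_bounded V.
have e2 : 0 < e / 2 by rewrite divr_gt0.
have [M M0 HM] := expn_approx K0 e2.
exists ((1 + (M%:R^-1)%:C *: V) ^+ M) => z z1.
have [gz g0] := HM _ (VK z z1).
rewrite horner_exp hornerD hornerZ -[in 1.[z]]polyC1 hornerC.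
split => //.
have := log1p_poly_approx N k0 k1 z1.
have u0 : 0 < normc (1 + k%:C * z).
  by rewrite (lt_le_trans _ (normc_1kz_ge (ltW k0) z1)) // subr_gt0.
rewrite lnXn // -(mulr_natl (ln _)); set l := ln _; set L := Re _ => lL.
have VE : Re V.[z] = s / 2 * L by rewrite hornerZ ReZ.
move: gz; rewrite VE; set G := ln _ => gz.
have -> : G - s * l = (G - 2 * (s / 2 * L)) - s / 2 * (2 * l - 2 * L) by field.
rewrite (le_trans (ler_normB _ _)) // [leRHS](splitr e) lerD //.
rewrite normrM ger0_norm ?divr_ge0 ?(ltW s0) //.
have s2 : 0 < s / 2 by rewrite divr_gt0.
rewrite -(ler_pM2l s2) in lL;
  apply: (le_trans lL).
rewrite mulrA ler_pdivrMr ?subr_gt0 //.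
move: HN; rewrite ltr_pdivlMr ?mulr_gt0 //; lra.
Qed.

Lemma ler_expR_mul (R : realType) (A B : R) : 0 < A -> 0 < B ->
  (forall e, 0 < e -> A <= expR e * B) -> A <= B.
Proof.
move=> A0 B0 H; rewrite -ler_ln ?posrE //; apply/ler_addgt0Pr => e /H.
rewrite -ler_ln ?posrE ?mulr_gt0 ?expR_gt0 // lnM ?posrE ?expR_gt0 //.
by rewrite expRK addrC.
Qed.

Lemma continuous_normc_powR (R : realType) (f : R -> R[i]) (s : R) : 0 < s ->
  ccontinuous f -> continuous (fun t => normc (f t) `^ s).
Proof.
move=> s0 cf; apply: continuous_powR_ge0 => // [t|]; first exact: normc_ge0.
exact: continuous_normc.
Qed.

(** The approximation of |1 + k z|^s by |g|^2 holds on the whole closed disc, so it applies both at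
    z and at W(z); the H^2 inequality for [g \Po W] links the two. Each use costs a factor
    [expR (e / 2)]. *)
Lemma subordination_poly (R : realType) (k s : R) (W : {poly R[i]}) :
  0 < k -> k < 1 -> 0 < s -> W.[0] = 0 ->
  (forall t : R, normc W.[expi t] <= 1) ->
  icirc (fun t => normc (1 + k%:C * W.[expi (- t)]) `^ s) <=
  icirc (fun t => normc (1 + k%:C * expi t) `^ s).
Proof.
move=> k0 k1 s0 W0 W1.
have u0 (z : R[i]) : normc z <= 1 -> 0 < normc (1 + k%:C * z).
  move=> z1; rewrite (lt_le_trans _ (normc_1kz_ge (ltW k0) z1)) //.
  by rewrite subr_gt0.
have e1 (t : R) : normc (expi t) <= 1 by rewrite normc_expi.
have cL : continuous (fun t : R => normc (1 + k%:C * W.[expi (- t)]) `^ s).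
  apply: continuous_normc_powR => //.
  apply: ccontinuousD; first exact: ccontinuous_cst.
  apply: ccontinuousM; first exact: ccontinuous_cst.
  exact/ccontinuous_horner/ccontinuous_expiN.
have cR : continuous (fun t : R => normc (1 + k%:C * expi t) `^ s).
  apply: continuous_normc_powR => //.
  apply: ccontinuousD; first exact: ccontinuous_cst.
  by apply: ccontinuousM; [exact: ccontinuous_cst|exact: ccontinuous_expi].
apply: ler_expR_mul => [||e e0].
- by apply: icirc_gt0 => // t; rewrite powR_gt0 ?u0.
- by apply: icirc_gt0 => // t; rewrite powR_gt0 ?u0.
have e2 : 0 < e / 2 by rewrite divr_gt0.
have [g Hg] := normc_powR_approx k0 k1 s0 e2.
have cg : continuous (fun t : R => normc g.[W.[expi (- t)]] ^+ 2).
  rewrite (_ : (fun t => _) = fun t => normc (g \Po W).[expi (- t)] ^+ 2).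
    have c : continuous (fun t : R => normc (g \Po W).[expi (- t)]).
      exact/continuous_normc/ccontinuous_horner/ccontinuous_expiN.
    by move=> t; apply: cvgM; exact: c.
  by apply/funext => t; rewrite horner_comp.
have cge : continuous (fun t : R => normc g.[expi t] ^+ 2).
  exact: continuous_sqnormc_horner.
have cZ (f : R -> R) : continuous f -> continuous (fun t => expR (e / 2) * f t).
  by move=> cf t; apply: cvgM; [exact: cvg_cst|exact: cf].
apply: (@le_trans _ _ (expR (e / 2) *
    icirc (fun t => normc g.[W.[expi (- t)]] ^+ 2))).
  rewrite -icircZ //; apply: le_icirc => // [|t]; first exact: cZ.
  have [H1 H2] := Hg _ (W1 (- t)).
  rewrite powR_expR ?u0 // -(@lnK _ (normc g.[_] ^+ 2)) ?posrE;
    last by rewrite exprn_gt0 // normc_gt0.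
  rewrite -expRD ler_expR; move: H1; rewrite ler_norml; lra.
rewrite [in expR e](splitr e) expRD -mulrA ler_pM2l ?expR_gt0 //.
apply: (@le_trans _ _ (sqnorm2 g)).
  apply: le_trans (sqnorm2_comp_le g W0 W1).
  rewrite -sqnorm2_expiN le_eqVlt; apply/orP; left; apply/eqP; congr icirc.
  by apply/funext => t; rewrite horner_comp.
rewrite -icircZ //; apply: le_icirc => // [|t]; first exact: cZ.
have [H1 H2] := Hg _ (e1 t).
rewrite powR_expR ?u0 // -(@lnK _ (normc g.[_] ^+ 2)) ?posrE;
  last by rewrite exprn_gt0 // normc_gt0.
rewrite -expRD ler_expR; move: H1; rewrite ler_norml; lra.
Qed.

Lemma subordination (R : realType) (k s : R) (Om : R[i] -> R[i]) :
  0 < k -> k < 1 -> 0 < s -> disc_approx Om -> Om 0 = 0 ->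
  (forall t : R, normc (Om (expi t)) <= 1) ->
  continuous (fun t => normc (1 + k%:C * Om (expi (- t))) : R) ->
  icirc (fun t => normc (1 + k%:C * Om (expi (- t))) `^ s) <=
  icirc (fun t => normc (1 + k%:C * expi t) `^ s).
Proof.
move=> k0 k1 s0 aOm Om0 Om1 cOm.
have k1' : 0 < 1 - k by rewrite subr_gt0.
have u0 (z : R[i]) : normc z <= 1 -> 0 < normc (1 + k%:C * z).
  by move=> z1; rewrite (lt_le_trans _ (normc_1kz_ge (ltW k0) z1)).
have cR : continuous (fun t : R => normc (1 + k%:C * expi t) `^ s).
  apply: continuous_normc_powR => //.
  apply: ccontinuousD; first exact: ccontinuous_cst.
  by apply: ccontinuousM; [exact: ccontinuous_cst|exact: ccontinuous_expi].
have cL : continuous (fun t : R => normc (1 + k%:C * Om (expi (- t))) `^ s).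
  by apply: continuous_powR_ge0 => // t; exact: normc_ge0.
apply: ler_expR_mul => [||e e0].
- by apply: icirc_gt0 => // t; rewrite powR_gt0 ?u0.
- by apply: icirc_gt0 => // t; rewrite powR_gt0 ?u0 // normc_expi.
(* Replacing [Om] by [W] changes 1 + k Om by at most 4 d = (1 - k) (exp (e/s) - 1) <= (exp (e/s) -
   1) |1 + k W|; the power s turns the factor exp (e/s) into exp e. *)
pose d := (1 - k) * (expR (e / s) - 1) / 4.
have d0 : 0 < d.
  by rewrite divr_gt0 // mulr_gt0 // subr_gt0 expR_gt1 divr_gt0.
have [p pOm] := aOm d d0.
pose c := 1 + 2 * d.
have c1 : 1 < c by rewrite /c; lra.
have c0 : c%:C != 0 by rewrite -normc_gt0 normcR gtr0_norm; lra.
(* The approximant [p] need neither vanish at 0 nor be bounded by 1 on the circle. Subtracting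
   [p.[0]], of modulus at most d, and dividing by [c] = 1 + 2 d repairs both. *)
pose W := (c^-1)%:C *: (p - (p.[0])%:P).
have WE z : W.[z] * c%:C = p.[z] - p.[0].
  rewrite hornerZ hornerD hornerN hornerC mulrAC -rmorphM mulVf ?mul1r //; lra.
have W0 : W.[0] = 0 by rewrite hornerZ hornerD hornerN hornerC subrr mulr0.
have p0 : normc p.[0] <= d.
  rewrite -normc_opp -[X in normc X]add0r -{1}Om0 pOm //.
  by rewrite ComplexField.Normc.normc0.
have OmW z : normc z <= 1 -> normc (Om z - W.[z] * c%:C) <= 2 * d.
  move=> z1; rewrite WE (_ : _ - _ = (Om z - p.[z]) + p.[0]); last ring.
  rewrite (le_trans (normc_le_normD _ _)) //; have := pOm z z1; lra.
have W1 (t : R) : normc W.[expi t] <= 1.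
  have c0' : 0 < c by lra.
  rewrite -(ler_pM2r c0') mul1r -{1}(ger0_norm (ltW c0')) -normcR.
  rewrite -ComplexField.Normc.normcM.
  rewrite (_ : _ * _ = Om (expi t) - (Om (expi t) - W.[expi t] * c%:C));
    last ring.
  rewrite (le_trans (normc_le_normD _ _)) // normc_opp lerD //.
  by apply: OmW; rewrite normc_expi.
apply: (@le_trans _ _ (expR e *
    icirc (fun t => normc (1 + k%:C * W.[expi (- t)]) `^ s))); last first.
  by rewrite ler_pM2l ?expR_gt0 // subordination_poly.
have cW : continuous (fun t : R => normc (1 + k%:C * W.[expi (- t)]) `^ s).
  apply: continuous_normc_powR => //.
  apply: ccontinuousD; first exact: ccontinuous_cst.
  apply: ccontinuousM; first exact: ccontinuous_cst.
  exact/ccontinuous_horner/ccontinuous_expiN.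
rewrite -icircZ //; apply: le_icirc => // [|t].
  by move=> t; apply: cvgM; [exact: cvg_cst|exact: cW].
have -> : expR e = expR (e / s) `^ s by rewrite -expRM divfK // gt_eqF.
rewrite -powRM ?expR_ge0 ?normc_ge0 //.
apply: ge0_ler_powR;
  rewrite ?nnegrE ?normc_ge0 ?mulr_ge0 ?expR_ge0 ?normc_ge0 ?(ltW s0) //.
set w := expi (- t).
have w1 : normc w <= 1 by rewrite normc_expi.
have Ww : normc W.[w] <= 1 := W1 _.
have := normc_1kz_ge (ltW k0) Ww; set x := normc (1 + _) => xk.
have -> : 1 + k%:C * Om w = (1 + k%:C * W.[w]) +
    (k%:C * (Om w - W.[w] * c%:C) + k%:C * (W.[w] * (2 * d)%:C)).
  by rewrite /c rmorphD /=; ring.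
rewrite (le_trans (normc_le_normD _ _)) // -/x.
have H1 : normc (k%:C * (Om w - W.[w] * c%:C)) <= 2 * d.
  rewrite ComplexField.Normc.normcM normcR gtr0_norm // -[leRHS]mul1r.
  by rewrite ler_pM ?normc_ge0 ?(ltW k0) ?(ltW k1) ?OmW.
have H2 : normc (k%:C * (W.[w] * (2 * d)%:C)) <= 2 * d.
  have d2 : 0 < 2 * d by lra.
  rewrite !ComplexField.Normc.normcM !normcR (gtr0_norm k0) (gtr0_norm d2).
  rewrite mulrA ler_piMl ?(ltW d2) //.
  by rewrite mulr_ile1 ?normc_ge0 ?(ltW k0) ?(ltW k1).
have := normc_le_normD (k%:C * (Om w - W.[w] * c%:C))
  (k%:C * (W.[w] * (2 * d)%:C)).
set y := normc (_ + _) => Hy.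
have dE : 4 * d = (1 - k) * (expR (e / s) - 1) by rewrite /d; field.
have e1 : 0 <= expR (e / s) - 1.
  by rewrite subr_ge0 ltW // expR_gt1 divr_gt0.
have := ler_wpM2r e1 xk; lra.
Qed.

(** * Polynomials with all roots in a disc *)

(* The Apollonius disc |u - x| <= c |u|, in the form centre/radius, which makes
   it visibly stable under addition of the pairs (u, x). *)
Lemma apollonius_disc (R : rcfType) (u : R[i]) (x c : R) :
  0 <= x -> 0 <= c -> c < 1 ->
  (normc (u - x%:C) <= c * normc u) =
  (normc ((1 - c ^+ 2)%:C * u - x%:C) <= x * c).
Proof.
move=> x0 c0 c1.
rewrite -[LHS](@ler_pXn2r _ 2) ?nnegrE ?mulr_ge0 ?normc_ge0 //.
rewrite -[RHS](@ler_pXn2r _ 2) ?nnegrE ?mulr_ge0 ?normc_ge0 //.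
rewrite !exprMn !normc_sqr.
have d0 : 0 < 1 - c ^+ 2.
  by rewrite subr_gt0 expr_lt1.
(* After squaring, the right-hand difference is exactly [1 - c ^+ 2] times the left-hand one. *)
rewrite -subr_ge0 -[RHS]subr_ge0 -(pmulr_rge0 _ d0); congr (0 <= _).
case: u => a b /=; ring.
Qed.

(** A root a contributes u = z / (z - a), and u - 1 = a / (z - a) gives |u - 1| <= c |u| with c = k
    / |z|. In centre/radius form these conditions add up over the roots, with x counting them. *)
Lemma normc_logderiv_le (R : rcfType) (n : nat) (P : {poly R[i]}) (k : R)
    (z : R[i]) :
  size P = n.+1 -> 0 <= k -> (forall a, root P a -> normc a <= k) ->
  k < normc z -> normc (P.[z] *+ n - z * P^`().[z]) <= k * normc P^`().[z].
Proof.
move=> sP k0 rP kz.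
have z0 : 0 < normc z := le_lt_trans k0 kz.
have zn0 : z != 0 by rewrite -normc_gt0.
have [s PE] := closed_field_poly_normal P.
have lP : lead_coef P != 0 by rewrite lead_coef_eq0 -size_poly_eq0 sP.
have ss : size s = n.
  apply: succn_inj; rewrite -sP PE size_scale // size_prod_XsubC //.
have sk a : a \in s -> normc a <= k.
  by move=> sa; apply: rP; rewrite PE rootZ // root_prod_XsubC.
set p := \prod_(a <- s) ('X - a%:P) in PE.
pose c := k / normc z.
have c0 : 0 <= c by rewrite divr_ge0 // ltW.
have c1 : c < 1 by rewrite ltr_pdivrMr // mul1r.
have za a : normc a <= k -> z - a != 0.
  move=> ak; rewrite -normc_gt0 (lt_le_trans _ (normc_leB _ _)) // subr_gt0.
  exact: le_lt_trans kz.
have [p0 Hp] : p.[z] != 0 /\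
    normc ((1 - c ^+ 2)%:C * (z * p^`().[z] / p.[z]) - n%:R%:C) <= n%:R * c.
  rewrite /p -ss; elim: s sk {PE p ss} => [|a s IH] sk.
    rewrite big_nil -(polyC1 R[i]) derivC hornerC oner_neq0 horner0.
    by rewrite mulr0 mul0r mulr0 subrr ComplexField.Normc.normc0 mul0r.
  have [|p0 Hp] := IH; first by move=> b bs; rewrite sk // in_cons bs orbT.
  have ak : normc a <= k by rewrite sk ?mem_head.
  have za0 := za a ak.
  rewrite big_cons; set p := \prod_(_ <- s) _ in p0 Hp *.
  split; first by rewrite hornerM hornerXsubC mulf_neq0.
  have -> : z * (('X - a%:P) * p)^`().[z] / (('X - a%:P) * p).[z] =
      z / (z - a) + z * p^`().[z] / p.[z].
    rewrite derivM derivXsubC hornerD !hornerM !hornerXsubC hornerC.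
    by field; rewrite p0 za0.
  have -> : (size (a :: s))%:R%:C = 1%:C + (size s)%:R%:C :> R[i].
    by rewrite -rmorphD /= nat1r.
  rewrite mulrDr opprD addrACA (le_trans (normc_le_normD _ _)) //.
  rewrite /= -nat1r mulrDl lerD //.
  rewrite -apollonius_disc //.
  have -> : z / (z - a) - 1%:C = a / (z - a) by rewrite rmorph1; field.
  rewrite !ComplexField.Normc.normcM mulrA /c divfK ?gt_eqF //.
  by rewrite ler_wpM2r // normc_ge0.
have Pz : P.[z] = lead_coef P * p.[z] by rewrite {1}PE hornerZ.
have dPz : P^`().[z] = lead_coef P * p^`().[z] by rewrite {1}PE derivZ hornerZ.
rewrite -apollonius_disc // in Hp.
have -> : P.[z] *+ n - z * P^`().[z] =
    - (lead_coef P * p.[z] * (z * p^`().[z] / p.[z] - n%:R%:C)).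
  by rewrite Pz dPz -mulr_natr rmorph_nat; field.
rewrite normc_opp ComplexField.Normc.normcM.
have -> : k * normc P^`().[z] =
    normc (lead_coef P * p.[z]) * (c * normc (z * p^`().[z] / p.[z])).
  rewrite dPz !ComplexField.Normc.normcM ComplexField.Normc.normcV /c.
  by field; rewrite !gt_eqF ?normc_gt0.
by rewrite ler_wpM2l ?normc_ge0.
Qed.

Lemma normc_natr (R : rcfType) n : normc (n%:R : R[i]) = n%:R.
Proof. by rewrite -(rmorph_nat (real_complex R)) normcR ger0_norm. Qed.

(** At a zero of [P'] the previous inequality forces P(z) = 0, a root outside the disc. *)
Lemma gauss_lucas_disc (R : rcfType) (n : nat) (P : {poly R[i]}) (k : R)
    (z : R[i]) :
  size P = n.+2 -> 0 <= k -> (forall a, root P a -> normc a <= k) ->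
  k < normc z -> P^`().[z] != 0.
Proof.
move=> sP k0 rP kz; apply/eqP => dP0.
have := normc_logderiv_le sP k0 rP kz.
rewrite dP0 mulr0 subr0 ComplexField.Normc.normc0 mulr0 -mulr_natr.
rewrite ComplexField.Normc.normcM normc_natr pmulr_lle0 ?ltr0n //.
rewrite le_eqVlt ltNge normc_ge0 orbF normc_eq0 => P0.
by have := rP z P0; rewrite leNgt kz.
Qed.

(** Reversal with respect to a nominal degree [n]: if the true degree is smaller, the result
    vanishes at 0, which is how Om(0) = 0 arises. *)
Definition poly_rev (R : nzRingType) (n : nat) (P : {poly R}) : {poly R} :=
  \poly_(i < n.+1) P`_(n - i).

Lemma horner_poly_rev (F : fieldType) (n : nat) (P : {poly F}) (w : F) :
  (size P <= n.+1)%N -> w != 0 ->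
  (poly_rev n P).[w] = w ^+ n * P.[w^-1].
Proof.
move=> sP w0; rewrite horner_poly (horner_coef_wide _ sP) mulr_sumr.
rewrite (reindex_inj rev_ord_inj); apply: eq_bigr => i _ /=.
have iN : (i <= n)%N by rewrite -ltnS.
rewrite subSS subKn // exprVn.
by rewrite mulrCA -expfB_cond // (negPf w0).
Qed.

Lemma horner_poly_rev0 (R : nzRingType) (n : nat) (P : {poly R}) :
  (poly_rev n P).[0] = P`_n.
Proof. by rewrite horner_coef0 coef_poly subn0. Qed.

(** Minimum principle for B(w) = w^n P(k / w), which has no zero in the closed disc (m > 0 excludes
    the boundary) and satisfies |B| >= m on the circle. The point w = 0 gives the leading
    coefficient, w = k / z the growth. *)
Lemma min_growth (R : realType) (n : nat) (P : {poly R[i]}) (k m : R) :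
  size P = n.+1 -> 0 < k -> (forall a, root P a -> normc a <= k) -> 0 < m ->
  (forall z, normc z = k -> m <= normc P.[z]) ->
  m <= k ^+ n * normc (lead_coef P) /\
  forall z, k < normc z -> m * normc z ^+ n <= k ^+ n * normc P.[z].
Proof.
move=> sP k0 rP m0 mP.
have kC0 : k%:C != 0 by rewrite -normc_gt0 normcR gtr0_norm.
have sX : size (k%:C *: 'X : {poly R[i]}) = 2 by rewrite size_scale ?size_polyX.
pose Q := P \Po (k%:C *: 'X).
have sQ : size Q = n.+1 by rewrite size_comp_poly2.
have Qn : Q`_n = k%:C ^+ n * lead_coef P.
  have <- : lead_coef Q = Q`_n by rewrite lead_coefE sQ.
  by rewrite lead_coef_comp ?sX // lead_coefZ lead_coefX mulr1 sP mulrC.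
have Qz z : Q.[z] = P.[k%:C * z] by rewrite horner_comp hornerZ hornerX.
pose B := poly_rev n Q.
have Bw w : w != 0 -> B.[w] = w ^+ n * P.[k%:C / w].
  by move=> w0; rewrite horner_poly_rev ?sQ // Qz.
have B00 : B.[0] = k%:C ^+ n * lead_coef P by rewrite horner_poly_rev0.
have kw w : normc (k%:C / w) = k / normc w.
  rewrite ComplexField.Normc.normcM ComplexField.Normc.normcV normcR.
  by rewrite gtr0_norm.
have B0 w : normc w <= 1 -> B.[w] != 0.
  have [->|w0 w1] := eqVneq w 0.
    by rewrite B00 mulf_neq0 ?expf_neq0 // lead_coef_eq0 -size_poly_eq0 sP.
  rewrite Bw // mulf_neq0 ?expf_neq0 //; apply/negP => rPw.
  have := rP _ rPw; rewrite kw ler_pdivrMr ?normc_gt0 // ler_pMr // => w1'.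
  have /mP : normc (k%:C / w) = k.
    by rewrite kw (_ : normc w = 1) ?divr1 //; apply/eqP; rewrite eq_le w1.
  by rewrite (eqP rPw) ComplexField.Normc.normc0 leNgt m0.
have Bm (t : R) : m <= normc B.[expi t].
  have e0 : expi t != 0 by rewrite -normc_gt0 normc_expi.
  rewrite Bw // ComplexField.Normc.normcM normcX normc_expi expr1n mul1r mP //.
  by rewrite kw normc_expi divr1.
have kn : normc (k%:C ^+ n) = k ^+ n by rewrite normcX normcR gtr0_norm.
split.
  have := min_modulus B0 m0 Bm (_ : normc 0 < 1).
  rewrite B00 ComplexField.Normc.normcM kn; apply.
  by rewrite ComplexField.Normc.normc0.
move=> z kz; have z0 : 0 < normc z := lt_trans k0 kz.
have zn0 : z != 0 by rewrite -normc_gt0.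
have := min_modulus B0 m0 Bm (_ : normc (k%:C / z) < 1).
rewrite kw ltr_pdivrMr // mul1r => /(_ kz).
rewrite Bw ?mulf_neq0 ?invr_neq0 // invfM invrK mulrA divff // mul1r.
rewrite ComplexField.Normc.normcM normcX kw expr_div_n mulrAC.
by rewrite ler_pdivlMr ?exprn_gt0.
Qed.

(* The polynomials P + lam * m * (z / k)^n, |lam| < 1, still have their roots in
   the disc, and the added term cancels in n P - z P'. *)
Lemma normc_logderiv_min_le (R : realType) (n : nat) (P : {poly R[i]})
    (k m : R) (z : R[i]) :
  size P = n.+2 -> 0 < k -> k < 1 -> (forall a, root P a -> normc a <= k) ->
  0 <= m -> (forall z, normc z = k -> m <= normc P.[z]) -> normc z = 1 ->
  normc (P.[z] *+ n.+1 - z * P^`().[z]) + n.+1%:R * (m / k ^+ n) <=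
  k * normc P^`().[z].
Proof.
move=> sP k0 k1 rP; rewrite le_eqVlt => /predU1P[<- _ z1|m0 mP z1].
  by rewrite mul0r mulr0 addr0 normc_logderiv_le // ?ltW // z1.
have [mlead mgrow] := min_growth sP k0 rP m0 mP.
pose h := m / k ^+ n.+1.
have kn0 : 0 < k ^+ n.+1 by rewrite exprn_gt0.
have h0 : 0 < h by rewrite divr_gt0.
(* [lam * T] is what the perturbation [lam * h * z ^+ n.+1] adds to z P'(z). *)
pose T := n.+1%:R * h%:C * z ^+ n.+1.
pose tau := n.+1%:R * h.
have tau0 : 0 < tau by rewrite mulr_gt0 ?ltr0n.
have nT : normc T = tau.
  rewrite !ComplexField.Normc.normcM normc_natr normcX z1 expr1n mulr1 normcR.
  by rewrite gtr0_norm.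
set N := _ - _; set v := z * P^`().[z].
have key lam : normc lam < 1 ->
    v + lam * T != 0 /\ normc N <= k * normc (v + lam * T).
  move=> lam1.
  pose F := P + (lam * h%:C) *: 'X^(n.+1).
  have lam_h : normc (lam * h%:C) < h.
    rewrite ComplexField.Normc.normcM normcR gtr0_norm //.
    by rewrite gtr_pMl.
  (* [mlead] prevents the leading coefficients from cancelling, so the degree is kept; [mgrow] will
     keep the roots in the disc. *)
  have coefF : F`_n.+1 != 0.
    rewrite coefD coefZ coefXn eqxx mulr1.
    rewrite (_ : P`_n.+1 = lead_coef P); last by rewrite lead_coefE sP.
    rewrite -(opprK (_ * _)) subr_eq0; apply: contraTneq lam_h => E.
    rewrite -leNgt -normc_opp -E /h ler_pdivrMr // mulrC //.
  have sF : size F = n.+2.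
    apply/eqP; rewrite eqn_leq; apply/andP; split.
      rewrite (leq_trans (size_polyD _ _)) // geq_max sP leqnn /=.
      by rewrite (leq_trans (size_scale_leq _ _)) // size_polyXn.
    rewrite ltnNge; apply/negP => sF.
    by move: coefF; rewrite nth_default ?eqxx.
  have rF a : root F a -> normc a <= k.
    move=> rFa; rewrite leNgt; apply/negP => ka.
    have a0 : 0 < normc a := lt_trans k0 ka.
    have := mgrow a ka.
    have -> : P.[a] = - (lam * h%:C * a ^+ n.+1).
      have := rFa; rewrite /root hornerD hornerZ hornerXn addr_eq0 => /eqP.
      by [].
    rewrite normc_opp ComplexField.Normc.normcM normcX mulrA.
    rewrite ler_pM2r ?exprn_gt0 // leNgt => /negP; apply.
    by rewrite mulrC -ltr_pdivlMr.
  have kz : k < normc z by rewrite z1.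
  have FN : F.[z] *+ n.+1 - z * F^`().[z] = N.
    rewrite /F /N hornerD hornerZ hornerXn derivD derivZ derivXn hornerD.
    rewrite hornerZ hornerMn hornerXn /= exprS; ring.
  have Fv : z * F^`().[z] = v + lam * T.
    rewrite /F /v /T derivD derivZ derivXn hornerD hornerZ.
    rewrite hornerMn hornerXn /= exprS; ring.
  have := normc_logderiv_le sF (ltW k0) rF kz.
  have := gauss_lucas_disc sF (ltW k0) rF kz.
  rewrite FN -Fv ComplexField.Normc.normcM z1 mul1r => dF ->; split => //.
  by rewrite mulf_neq0 // -normc_gt0 z1.
have T0 : T != 0 by rewrite -normc_gt0 nT.
(* If |v| < |T|, then lam = - v / T would be admissible and would make z F'(z) vanish, against
   Gauss-Lucas. *)
have tau_v : tau <= normc v.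
  rewrite leNgt; apply/negP => vt.
  have [|] := key (- v / T).
    rewrite ComplexField.Normc.normcM normc_opp ComplexField.Normc.normcV nT.
    by rewrite ltr_pdivrMr // mul1r.
  by rewrite divfK // subrr eqxx.
have v0 : 0 < normc v := lt_le_trans tau0 tau_v.
have vn0 : v != 0 by rewrite -normc_gt0.
(* Here [lam] has modulus x and is rotated so that [lam * T] points opposite to [v]; x then tends to
   1. *)
have Hx x : 0 <= x -> x < 1 -> normc N <= k * (normc v - x * tau).
  move=> x0 x1; have xt0 : 0 <= x * tau := mulr_ge0 x0 (ltW tau0).
  have [|_] := key (- (x * tau / normc v)%:C * v / T).
    rewrite 2!ComplexField.Normc.normcM normc_opp ComplexField.Normc.normcV nT.
    rewrite normcR ger0_norm; last exact: divr_ge0 xt0 (normc_ge0 _).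
    by rewrite divfK ?gt_eqF // mulfK ?gt_eqF.
  rewrite divfK // (_ : v + _ = (1 - x * tau / normc v)%:C * v); last first.
    by rewrite rmorphB /=; ring.
  have xt : x * tau / normc v <= 1.
    by rewrite ler_pdivrMr // mul1r (le_trans _ tau_v) // ler_piMl // ltW.
  rewrite ComplexField.Normc.normcM normcR ger0_norm ?subr_ge0 //.
  by rewrite mulrBl mul1r divfK ?gt_eqF.
have -> : n.+1%:R * (m / k ^+ n) = k * tau.
  by rewrite /tau /h exprS; field; rewrite expf_neq0 gt_eqF.
have -> : normc P^`().[z] = normc v.
  by rewrite /v ComplexField.Normc.normcM z1 mul1r.
rewrite -lerBrDr -mulrBr; apply/ler_addgt0Pr => e e0.
pose x := Num.max 0 (1 - e / (k * tau)).
have x0 : 0 <= x by rewrite le_max lexx.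
have kt : 0 < k * tau by rewrite mulr_gt0.
have x1 : x < 1 by rewrite gt_max ltr01 /= ltrBlDr ltrDl divr_gt0.
have x2 : 1 - e / (k * tau) <= x by rewrite le_max lexx orbT.
have kx : k * tau - e <= k * tau * x.
  apply: le_trans (ler_wpM2l (ltW kt) x2).
  by rewrite (mulrBr (k * tau) 1) mulr1 [X in _ <= _ - X]mulrC divfK ?gt_eqF.
have := Hx x x0 x1; lra.
Qed.

(** * The case k < 1 *)

(** Young's inequality applied to f / A and g / B, then integrated. Positive upper bounds a, b in
    place of the integrals make the normalisation legitimate and let the subordination bound be
    inserted directly. *)
Lemma icirc_holder (R : realType) (f g : R -> R) (p q a b : R) :
  continuous f -> continuous g ->
  (forall t, 0 <= f t) -> (forall t, 0 <= g t) ->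
  0 < p -> 0 < q -> p^-1 + q^-1 = 1 -> 0 < a -> 0 < b ->
  icirc (fun t => f t `^ p) <= a -> icirc (fun t => g t `^ q) <= b ->
  icirc (fun t => f t * g t) <= a `^ p^-1 * b `^ q^-1.
Proof.
move=> cf cg f0 g0 p0 q0 pq a0 b0 fa gb.
set A := a `^ _; set B := b `^ _.
have A0 : 0 < A by rewrite powR_gt0.
have B0 : 0 < B by rewrite powR_gt0.
have scale (x y e : R) : 0 <= x -> 0 < y -> 0 < e ->
    (x / y `^ e^-1) `^ e = y^-1 * x `^ e.
  move=> x0 y0 e0; rewrite powRM ?invr_ge0 ?powR_ge0 // mulrC; congr (_ * _).
  rewrite -powR_inv1 ?powR_ge0 // -!powRrM.
  by rewrite mulN1r mulrN mulVf ?gt_eqF // powR_inv1 // ltW.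
have young t : f t * g t <=
    (A * B * (p^-1 * a^-1)) * f t `^ p + (A * B * (q^-1 * b^-1)) * g t `^ q.
  have := @conjugate_powR R (f t / A) (g t / B) p q.
  rewrite !divr_ge0 ?f0 ?g0 ?(ltW A0) ?(ltW B0) // => /(_ isT isT p0 q0 pq).
  rewrite !scale // -(ler_pM2l (mulr_gt0 A0 B0)).
  have -> : A * B * (f t / A * (g t / B)) = f t * g t.
    by field; rewrite !gt_eqF.
  move=> H; apply: (le_trans H); rewrite le_eqVlt; apply/orP; left; apply/eqP.
  ring.
have cfp : continuous (fun t => f t `^ p) by exact: continuous_powR_ge0.
have cgq : continuous (fun t => g t `^ q) by exact: continuous_powR_ge0.
have cZ (c : R) (h : R -> R) : continuous h -> continuous (fun t => c * h t).
  by move=> ch t; apply: cvgM; [exact: cvg_cst|exact: ch].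
apply: (le_trans (le_icirc _ _ young)).
- by move=> t; apply: cvgM; [exact: cf|exact: cg].
- by move=> t; apply: cvgD; [exact: (cZ _ _ cfp)|exact: (cZ _ _ cgq)].
rewrite icircD ?icircZ //; [|exact: cZ..].
have AB0 : 0 < A * B by rewrite mulr_gt0.
apply: (@le_trans _ _ (A * B * (p^-1 * a^-1) * a + A * B * (q^-1 * b^-1) * b)).
  by rewrite lerD // ler_wpM2l // !mulr_ge0 ?invr_ge0 ?(ltW AB0) ?ltW.
rewrite -!mulrA !mulVf ?gt_eqF // !mulr1 !mulrA -mulrDr pq mulr1.
exact: lexx.
Qed.

Lemma expi_inv (R : realType) (t : R) : (expi t)^-1 = expi (- t).
Proof.
have H : expi t * expi (- t) = 1.
  rewrite expiN; apply/eqP; rewrite eq_complex /=; apply/andP.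
  by split; apply/eqP; [rewrite mulrN opprK -!expr2 cos2Dsin2|ring].
have e0 : expi t != 0 by rewrite -normc_gt0 normc_expi.
by apply: (mulfI e0); rewrite H divff.
Qed.

Lemma polar_derivativeE (R : realType) n (al : R[i]) (P : {poly R[i]}) z :
  size P = n.+1 ->
  (polar_derivative al P).[z] = P.[z] *+ n + (al - z) * P^`().[z].
Proof.
move=> sP; rewrite /polar_derivative sP /= hornerD hornerMn hornerM.
by rewrite hornerD hornerN hornerC hornerX.
Qed.

Lemma polar_derivative_ge (R : realType) n (al : R[i]) (P : {poly R[i]})
    (k : R) (z : R[i]) :
  size P = n.+1 -> 0 <= k -> (forall a, root P a -> normc a <= k) ->
  k < normc z ->
  (normc al - k) * normc P^`().[z] <= normc (polar_derivative al P).[z].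
Proof.
move=> sP k0 rP kz; rewrite (polar_derivativeE _ _ sP).
have -> : P.[z] *+ n + (al - z) * P^`().[z] =
    al * P^`().[z] - - (P.[z] *+ n - z * P^`().[z]) by ring.
apply: le_trans (normc_leB _ _).
rewrite normc_opp ComplexField.Normc.normcM mulrBl lerD2l lerN2.
exact: normc_logderiv_le.
Qed.

(** Hölder is applied to r-th powers; this takes the r-th root of the outcome. *)
Lemma Lnorm_exponents (R : realType) (x y a b r p q : R) :
  0 <= x -> 0 <= y -> 0 <= a -> 0 <= b -> 0 < r ->
  x `^ r * y <= b `^ p^-1 * a `^ q^-1 ->
  x * y `^ r^-1 <= b `^ (p * r)^-1 * a `^ (q * r)^-1.
Proof.
move=> x0 y0 a0 b0 r0 H.
have -> : x * y `^ r^-1 = (x `^ r * y) `^ r^-1.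
  by rewrite powRM ?powR_ge0 // -powRrM divff ?gt_eqF // powRr1.
have -> : b `^ (p * r)^-1 * a `^ (q * r)^-1 =
    (b `^ p^-1 * a `^ q^-1) `^ r^-1.
  by rewrite powRM ?powR_ge0 // -!powRrM !invfM.
apply: ge0_ler_powR => //; rewrite ?nnegrE ?invr_ge0 ?(ltW r0) //.
  by rewrite mulr_ge0 ?powR_ge0.
by rewrite mulr_ge0 ?powR_ge0.
Qed.

(* With w = 1/z, Om w = (n P z - z P' z + n beta m / k^(n-1)) / (k z P' z). *)
Lemma polar_Lnorm_lt1 (R : realType) (n : nat) (P : {poly R[i]}) (k m : R)
    (alpha beta : R[i]) (r p q : R) :
  size P = n.+2 -> 0 < k -> k < 1 -> (forall a, root P a -> normc a <= k) ->
  0 <= m -> (forall z, normc z = k -> m <= normc P.[z]) ->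
  k < normc alpha -> normc beta <= 1 ->
  0 < r -> 0 < p -> 0 < q -> p^-1 + q^-1 = 1 ->
  n.+1%:R * (normc alpha - k) *
    circle_Lnorm r (fun z => P.[z] + beta * (m / k ^+ n)%:C)
  <= circle_Lnorm (p * r) (fun z => 1 + k%:C * z) *
     circle_Lnorm (q * r) (fun z => (polar_derivative alpha P).[z]).
Proof.
move=> sP k0 k1 rP m0 mP ka b1 r0 p0 q0 pq.
have kC0 : k%:C != 0 by rewrite -normc_gt0 normcR gtr0_norm.
have ak0 : 0 < normc alpha - k by rewrite subr_gt0.
have dP z : 1 <= normc z -> P^`().[z] != 0.
  by move=> z1; apply: gauss_lucas_disc sP (ltW k0) rP _; exact: lt_le_trans z1.
set c := beta * (m / k ^+ n)%:C.
pose N := P *+ n.+1 - 'X * P^`() + (c *+ n.+1)%:P.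
have NE z : N.[z] = P.[z] *+ n.+1 - z * P^`().[z] + c *+ n.+1.
  by rewrite /N hornerD hornerC hornerD hornerN hornerM hornerX hornerMn.
have sdP : (size P^`() < n.+2)%N.
  by rewrite -sP lt_size_deriv // -size_poly_eq0 sP.
have sXdP : (size ('X * P^`())%R <= n.+2)%N.
  by rewrite mulrC (leq_trans (size_polyMleq _ _)) // size_polyX addn2.
have sN : (size N <= n.+2)%N.
  rewrite (leq_trans (size_polyD _ _)) // geq_max.
  rewrite (leq_trans (size_polyD _ _)) ?geq_max; last first.
    rewrite size_polyN sXdP andbT -scaler_nat.
    by rewrite (leq_trans (size_scale_leq _ _)) ?sP.
  by rewrite (leq_trans (size_polyC_leq1 _)).
(* As |beta| <= 1, the term with [m] in [normc_logderiv_min_le] pays for the constant [c]. *)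
have N_le z : normc z = 1 -> normc N.[z] <= k * normc P^`().[z].
  move=> z1; apply: le_trans (normc_logderiv_min_le sP k0 k1 rP m0 mP z1).
  rewrite NE (le_trans (normc_le_normD _ _)) // lerD2l.
  rewrite -mulr_natl ComplexField.Normc.normcM normc_natr ler_wpM2l //.
  rewrite ComplexField.Normc.normcM normcR ger0_norm.
    by rewrite ler_piMl ?divr_ge0 ?exprn_ge0 ?(ltW k0).
  by rewrite divr_ge0 ?exprn_ge0 ?(ltW k0).
pose A := poly_rev n.+1 N.
pose B := k%:C *: poly_rev n.+1 ('X * P^`()).
have AE w : w != 0 -> A.[w] = w ^+ n.+1 * N.[w^-1].
  exact: horner_poly_rev.
have BE w : w != 0 -> B.[w] = w ^+ n.+1 * (k%:C * (w^-1 * P^`().[w^-1])).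
  move=> w0; rewrite hornerZ horner_poly_rev // hornerM hornerX; ring.
(* The top coefficients of n P and z P' cancel, and the constant [c] sits in degree 0 < n + 1. *)
have A0 : A.[0] = 0.
  rewrite horner_poly_rev0 coefD coefC /= coefB coefMn coefXM /= coef_deriv.
  by rewrite subrr addr0.
have Pn : P`_n.+1 != 0.
  by rewrite -[n.+1]/(n.+2.-1) -sP -lead_coefE lead_coef_eq0 -size_poly_eq0 sP.
have B0 w : normc w <= 1 -> B.[w] != 0.
  have [->|w0 w1] := eqVneq w 0.
    rewrite hornerZ horner_poly_rev0 coefXM /= coef_deriv -mulr_natr.
    by rewrite !mulf_neq0 // pnatr_eq0.
  rewrite BE // !mulf_neq0 ?expf_neq0 ?invr_neq0 // dP //.
  by rewrite ComplexField.Normc.normcV invr_ge1 ?unitfE ?normc_gt0 ?normc_eq0.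
pose Om w := A.[w] * B.[w]^-1.
have aOm : disc_approx Om.
  by apply: disc_approxM; [exact: disc_approx_horner|exact: disc_approx_inv].
have Om0 : Om 0 = 0 by rewrite /Om A0 mul0r.
have OmE (t : R) : Om (expi t) =
    N.[expi (- t)] / (k%:C * (expi (- t) * P^`().[expi (- t)])).
  have e0 : expi t != 0 by rewrite -normc_gt0 normc_expi.
  rewrite /Om AE // BE // expi_inv invfM mulrACA divff ?mul1r //.
  by rewrite expf_neq0.
have e1 (t : R) : 1 <= normc (expi t) by rewrite normc_expi.
have Om1 (t : R) : normc (Om (expi t)) <= 1.
  rewrite OmE ComplexField.Normc.normcM ComplexField.Normc.normcV.
  rewrite ler_pdivrMr; last first.
    rewrite normc_gt0 !mulf_neq0 ?dP //.
    by rewrite -normc_gt0 normc_expi.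
  rewrite mul1r !ComplexField.Normc.normcM normcR (gtr0_norm k0).
  by rewrite normc_expi mul1r N_le ?normc_expi.
pose G (t : R) : R := normc (1 + k%:C * Om (expi (- t))).
pose F z := P.[z] + c.
have GE (t : R) : n.+1%:R * normc (F (expi t)) = normc P^`().[expi t] * G t.
  have e0 : expi t != 0 by rewrite -normc_gt0 normc_expi.
  rewrite /G OmE opprK -normc_natr -ComplexField.Normc.normcM.
  rewrite -[normc P^`().[_]]mul1r -(normc_expi t) -!ComplexField.Normc.normcM.
  congr normc; rewrite NE /F; field.
  by rewrite kC0 e0 dP.
have cdP : continuous (fun t : R => normc P^`().[expi t] : R).
  exact/continuous_normc/ccontinuous_horner/ccontinuous_expi.
have cF : ccontinuous (fun t : R => F (expi t)).
  apply: ccontinuousD; last exact: ccontinuous_cst.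
  exact/ccontinuous_horner/ccontinuous_expi.
have cG : continuous G.
  rewrite (_ : G = fun t =>
      n.+1%:R * normc (F (expi t)) / normc P^`().[expi t]).
    move=> t; apply: cvgM; last first.
      by apply: cvgV; [rewrite normc_eq0 dP|exact: cdP].
    by apply: cvgM; [exact: cvg_cst|exact: continuous_normc].
  by apply/funext => t; rewrite GE mulrC mulKf // normc_eq0 dP.
pose D (t : R) : R := normc (polar_derivative alpha P).[expi t].
have cD : continuous D.
  exact/continuous_normc/ccontinuous_horner/ccontinuous_expi.
have PD (t : R) : (normc alpha - k) * normc P^`().[expi t] <= D t.
  by apply: polar_derivative_ge sP (ltW k0) rP _; rewrite normc_expi.
have D0 t : 0 < D t.
  by apply: lt_le_trans (PD t); rewrite mulr_gt0 // normc_gt0 dP.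
set X := n.+1%:R * _.
have X0 : 0 <= X by rewrite mulr_ge0 // ltW.
have G0 t : 0 <= G t by exact: normc_ge0.
have FDG (t : R) : X * normc (F (expi t)) <= D t * G t.
  rewrite /X mulrAC GE -mulrA [G t * _]mulrC mulrA ler_wpM2r //.
  by rewrite mulrC.
have pr0 : 0 < p * r by rewrite mulr_gt0.
have qr0 : 0 < q * r by rewrite mulr_gt0.
pose a := icirc (fun t => D t `^ (q * r)).
pose b := icirc (fun t : R => normc (1 + k%:C * expi t) `^ (p * r)).
have a0 : 0 < a.
  apply: icirc_gt0 => [|t]; last by rewrite powR_gt0.
  by apply: continuous_powR_ge0 => // t; exact: ltW.
have b0 : 0 < b.
  apply: icirc_gt0 => [|t].
    apply: continuous_normc_powR => //.
    apply: ccontinuousD; first exact: ccontinuous_cst.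
    by apply: ccontinuousM; [exact: ccontinuous_cst|exact: ccontinuous_expi].
  rewrite powR_gt0 // (lt_le_trans _ (normc_1kz_ge (ltW k0) _)) ?subr_gt0 //.
  by rewrite normc_expi.
have cDr : continuous (fun t => D t `^ r).
  by apply: continuous_powR_ge0 => // t; exact: ltW.
have cGr : continuous (fun t => G t `^ r) by exact: continuous_powR_ge0.
have Gb : icirc (fun t => (G t `^ r) `^ p) <= b.
  under eq_fun do rewrite -powRrM mulrC.
  exact: subordination.
have Da : icirc (fun t => (D t `^ r) `^ q) <= a.
  under eq_fun do rewrite -powRrM mulrC.
  exact: lexx.
have holder := icirc_holder cGr cDr (fun t => powR_ge0 _ _)
  (fun t => powR_ge0 _ _) p0 q0 pq b0 a0 Gb Da.
pose I := icirc (fun t : R => normc (F (expi t)) `^ r).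
have I0 : 0 <= I by apply: icirc_ge0 => t; exact: powR_ge0.
have cFr : continuous (fun t : R => normc (F (expi t)) `^ r).
  exact: continuous_normc_powR.
apply: (Lnorm_exponents X0 I0 (ltW a0) (ltW b0) r0).
apply: le_trans holder; rewrite -(icircZ _ cFr); apply: le_icirc => [||t].
- by move=> t; apply: cvgM; [exact: cvg_cst|exact: cFr].
- by move=> t; apply: cvgM; [exact: cGr|exact: cDr].
rewrite -!powRM ?normc_ge0 ?(ltW (D0 t)) //.
apply: ge0_ler_powR; rewrite ?nnegrE ?(ltW r0) //.
- exact: mulr_ge0 X0 (normc_ge0 _).
- exact: mulr_ge0 (G0 t) (ltW (D0 t)).
- by apply: (le_trans (FDG t)); rewrite mulrC.
Qed.

(** * Passage to the limit *)

(* Families F x, |x| < 1, to which dominated convergence applies as x -> 0. *)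
Definition regular_family (R : realType) (F : R -> R -> R[i]) : Prop :=
  [/\ forall t, ccontinuous (F ^~ t), forall x, ccontinuous (F x) &
      exists2 M : R, 0 <= M & forall x t, `|x| < 1 -> normc (F x t) <= M].

Lemma regular_family_cst (R : realType) (c : R[i]) :
  regular_family (fun _ _ : R => c).
Proof.
split=> [t|x|]; [exact: ccontinuous_cst..|].
by exists (normc c) => //; exact: normc_ge0.
Qed.

Lemma regular_familyD (R : realType) (F G : R -> R -> R[i]) :
  regular_family F -> regular_family G ->
  regular_family (fun x t => F x t + G x t).
Proof.
move=> [F1 F2 [M M0 HM]] [G1 G2 [L L0 HL]]; split=> [t|x|].
- exact: ccontinuousD.
- exact: ccontinuousD.
- exists (M + L) => [|x t x1]; first exact: addr_ge0.
  by rewrite (le_trans (normc_le_normD _ _)) // lerD ?HM ?HL.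
Qed.

Lemma regular_familyM (R : realType) (F G : R -> R -> R[i]) :
  regular_family F -> regular_family G ->
  regular_family (fun x t => F x t * G x t).
Proof.
move=> [F1 F2 [M M0 HM]] [G1 G2 [L L0 HL]]; split=> [t|x|].
- exact: ccontinuousM.
- exact: ccontinuousM.
- exists (M * L) => [|x t x1]; first exact: mulr_ge0.
  by rewrite ComplexField.Normc.normcM ler_pM ?normc_ge0 ?HM ?HL.
Qed.

Lemma regular_family_horner (R : realType) (p : {poly R[i]})
    (F : R -> R -> R[i]) :
  regular_family F -> regular_family (fun x t => p.[F x t]).
Proof.
move=> rF; elim/poly_ind: p => [|p c IH].
  have -> : (fun x t => (0 : {poly R[i]}).[F x t]) = fun _ _ => 0.
    by apply/funext => x; apply/funext => t; rewrite horner0.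
  exact: regular_family_cst.
have -> : (fun x t => (p * 'X + c%:P).[F x t]) =
    fun x t => p.[F x t] * F x t + c.
  by apply/funext => x; apply/funext => t; rewrite hornerMXaddC.
apply: regular_familyD; last exact: regular_family_cst.
exact: regular_familyM.
Qed.

Lemma regular_family_expi (R : realType) :
  regular_family (fun _ t : R => expi t).
Proof.
split=> [t|x|]; [exact: ccontinuous_cst|exact: ccontinuous_expi|].
by exists 1 => // x t _; rewrite normc_expi.
Qed.

Lemma regular_family_expR (R : realType) (f : R -> R) :
  continuous f -> (forall x, `|x| < 1 -> f x <= 1) ->
  regular_family (fun x _ : R => (expR (f x))%:C).
Proof.
move=> cf f1; split=> [t|x|]; last 1 first.
- exists (expR 1) => [|x t x1]; first exact: expR_ge0.
  by rewrite normcR ger0_norm ?expR_ge0 // ler_expR f1.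
- split=> x; last exact: cvg_cst.
  by apply: (@continuous_comp _ _ _ f expR); [exact: cf|exact: continuous_expR].
- exact: ccontinuous_cst.
Qed.

(** Dominated convergence with the constant M^s; the outer power 1/s is continuous even where the
    integral vanishes. *)
Lemma circle_Lnorm_cvg (R : realType) (s : R) (F : R -> R[i] -> R[i]) :
  0 < s -> regular_family (fun x t => F x (expi t)) ->
  circle_Lnorm s (F x) @[x --> 0] --> circle_Lnorm s (F 0).
Proof.
move=> s0 [F1 F2 [M M0 HM]].
pose h x t : R := normc (F x (expi t)) `^ s.
have h0 x t : 0 <= h x t := powR_ge0 _ _.
have ch x : continuous (h x) by exact: continuous_normc_powR.
suff : {for 0, continuous (fun x : R => icirc (h x))}.
  have sV : 0 < s^-1 by rewrite invr_gt0.
  move/(continuous_at_powR_ge0 sV); apply => x.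
  by apply: icirc_ge0 => t.
have cI : {in `]-1, 1[%classic, continuous (fun x : R => icirc (h x))}.
  have CU := @continuity_under_integral R _ _ (@lebesgue_measure R) h
    `[0, 2 * pi] (measurable_itv _) (-1) 1 _ _ (fun=> M `^ s).
  apply: CU.
  - by move=> x _; exact: icirc_integrable.
  - by apply: aeW => t _ x _; exact: (continuous_normc_powR s0 (F1 t)).
  - by apply: icirc_integrable => t; exact: cvg_cst.
  - move=> x /=; rewrite in_itv /= -ltr_norml => x1; apply: aeW => t _.
    rewrite ger0_norm //.
    by apply: ge0_ler_powR; rewrite ?nnegrE ?normc_ge0 ?(ltW s0) ?HM.
by apply: cI; rewrite inE /= in_itv /= ltr01 ltrN10.
Qed.

(* The exponent [n%:Z - 1] is an integer, so that the case n = 0 is covered. *)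
Theorem theorem1p2 (R : realType) (n : nat) (P : {poly R[i]}) (k m : R)
    (alpha beta : R[i]) (r p q : R)
    (degP : size P = n.+1)
    (k_gt0 : 0 < k) (k_le1 : k <= 1)
    (rootsP : forall z : R[i], root P z -> normc z <= k)
    (m_min : is_min [set normc P.[z] | z in [set z : R[i] | normc z = k]] m)
    (alpha_ge : k <= normc alpha) (beta_le : normc beta <= 1)
    (r_gt0 : 0 < r) (p_gt1 : 1 < p) (q_gt1 : 1 < q)
    (pq_conj : p^-1 + q^-1 = 1) :
  n%:R * (normc alpha - k) *
    circle_Lnorm r (fun z => P.[z] + beta * (m / k ^ (n%:Z - 1))%:C)
  <= circle_Lnorm (p * r) (fun z => 1 + k%:C * z) *
     circle_Lnorm (q * r) (fun z => (polar_derivative alpha P).[z]).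
Proof.
have RHS0 : 0 <= circle_Lnorm (p * r) (fun z => 1 + k%:C * z) *
     circle_Lnorm (q * r) (fun z => (polar_derivative alpha P).[z]).
  by rewrite mulr_ge0 ?powR_ge0.
case: n degP => [|n] degP; first by rewrite !mul0r.
have -> : k ^ (n.+1%:Z - 1) = k ^+ n by rewrite intS addrC addKr.
move: alpha_ge; rewrite le_eqVlt => /predU1P[<-|ka].
  by rewrite subrr mulr0 mul0r.
have [[z0 _ mz0] mlb] := m_min.
have m0 : 0 <= m by rewrite -mz0 normc_ge0.
have mP z : normc z = k -> m <= normc P.[z] by move=> zk; apply: mlb; exists z.
have p0 : 0 < p := lt_trans ltr01 p_gt1.
have q0 : 0 < q := lt_trans ltr01 q_gt1.
(* With rho = exp x these are the three integrands for P(rho z) and k / rho. They make sense for x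
   of either sign, and at x = 0 they are the original ones. *)
pose F x z := P.[(expR x)%:C * z] +
  beta * (m / k ^+ n)%:C * (expR x)%:C ^+ n.
pose G x (z : R[i]) := 1 + k%:C * ((expR (- x))%:C * z).
pose D x z := P.[(expR x)%:C * z] *+ n.+1 +
  (alpha - z) * ((expR x)%:C * P^`().[(expR x)%:C * z]).
(* P(rho z) has its roots in |z| <= k / rho < 1 and the same lower bound m on the new circle; m / (k
   / rho)^n accounts for the factor rho^n in [F]. *)
have scaled x : 0 < x ->
    n.+1%:R * (normc alpha - k * expR (- x)) * circle_Lnorm r (F x) <=
    circle_Lnorm (p * r) (G x) * circle_Lnorm (q * r) (D x).
  move=> x0; set rho := expR x.
  have rho0 : 0 < rho := expR_gt0 x.
  have rhoC0 : rho%:C != 0 by rewrite -normc_gt0 normcR gtr0_norm.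
  have rho1 : expR (- x) < 1 by rewrite expR_lt1 oppr_lt0.
  have rhoN : rho * expR (- x) = 1 by rewrite -expRD subrr expR0.
  have k'0 : 0 < k * expR (- x) by rewrite mulr_gt0 ?expR_gt0.
  have k'k : k * expR (- x) < k by rewrite gtr_pMr.
  pose Q := P \Po (rho%:C *: 'X).
  have sX : size (rho%:C *: 'X : {poly R[i]}) = 2.
    by rewrite size_scale ?size_polyX.
  have sQ : size Q = n.+2 by rewrite size_comp_poly2.
  have QE z : Q.[z] = P.[rho%:C * z] by rewrite horner_comp hornerZ hornerX.
  have dQE z : Q^`().[z] = rho%:C * P^`().[rho%:C * z].
    rewrite deriv_comp hornerM horner_comp derivZ derivX !hornerZ hornerX.
    by rewrite hornerC mulr1 mulrC.
  have normr_rho z : normc (rho%:C * z) = rho * normc z.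
    by rewrite ComplexField.Normc.normcM normcR gtr0_norm.
  have rQ a : root Q a -> normc a <= k * expR (- x).
    rewrite /root QE => /rootsP; rewrite normr_rho => H.
    by rewrite -(ler_pM2l rho0) mulrCA rhoN mulr1.
  have mQ z : normc z = k * expR (- x) -> m <= normc Q.[z].
    by move=> zk; rewrite QE mP // normr_rho zk mulrCA rhoN mulr1.
  have FE : F x = fun z => Q.[z] + beta * (m / (k * expR (- x)) ^+ n)%:C.
    apply/funext => z; rewrite QE /F; congr (_ + _).
    rewrite -mulrA -rmorphXn -rmorphM /=; congr (_ * (_)%:C).
    rewrite exprMn expRN exprVn; field.
    by rewrite !expf_neq0 ?gt_eqF.
  have GE : G x = fun z => 1 + (k * expR (- x))%:C * z.
    by apply/funext => z; rewrite /G rmorphM mulrA.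
  have DE : D x = fun z => (polar_derivative alpha Q).[z].
    by apply/funext => z; rewrite (polar_derivativeE _ _ sQ) QE dQE.
  rewrite FE GE DE; exact: polar_Lnorm_lt1 sQ k'0 (lt_le_trans k'k k_le1) rQ
    m0 mQ (lt_trans k'k ka) beta_le r_gt0 p0 q0 pq_conj.
have F0 : F 0 = fun z => P.[z] + beta * (m / k ^+ n)%:C.
  by apply/funext => z; rewrite /F expR0 mul1r expr1n mulr1.
have G0 : G 0 = fun z => 1 + k%:C * z.
  by apply/funext => z; rewrite /G oppr0 expR0 mul1r.
have D0 : D 0 = fun z => (polar_derivative alpha P).[z].
  apply/funext => z.
  by rewrite (polar_derivativeE _ _ degP) /D expR0 !mul1r.
have rE : regular_family (fun x _ : R => (expR x)%:C).
  by apply: regular_family_expR => [x|x /ltr_normlW/ltW]; first exact: cvg_id.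
have rEN : regular_family (fun x _ : R => (expR (- x))%:C).
  apply: regular_family_expR => [x|x]; first exact: opp_continuous.
  by move=> x1; rewrite (le_trans (ler_norm _)) // normrN ltW.
have rEe : regular_family (fun x t : R => (expR x)%:C * expi t).
  by apply: regular_familyM => //; exact: regular_family_expi.
have rF : regular_family (fun x t => F x (expi t)).
  apply: regular_familyD; first exact: regular_family_horner.
  apply: regular_familyM; first exact: regular_family_cst.
  elim: (n) => [|j IH]; first exact: regular_family_cst.
  rewrite (_ : (fun x _ => _) = fun x _ : R => (expR x)%:C * (expR x)%:C ^+ j).
    exact: regular_familyM.
  by apply/funext => x; apply/funext => t; rewrite exprS.
have rG : regular_family (fun x t => G x (expi t)).
  apply: regular_familyD; first exact: regular_family_cst.
  apply: regular_familyM; first exact: regular_family_cst.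
  by apply: regular_familyM => //; exact: regular_family_expi.
have rD : regular_family (fun x t => D x (expi t)).
  apply: regular_familyD.
    rewrite (_ : (fun x t => _) =
        fun x t : R => (P *+ n.+1).[(expR x)%:C * expi t]).
      exact: regular_family_horner.
    by apply/funext => x; apply/funext => t; rewrite hornerMn.
  apply: regular_familyM.
    rewrite (_ : (fun x t => _) = fun _ t : R => alpha + (-1) * expi t).
      apply: regular_familyD; first exact: regular_family_cst.
      apply: regular_familyM; first exact: regular_family_cst.
      exact: regular_family_expi.
    by apply/funext => x; apply/funext => t; rewrite mulN1r.
  by apply: regular_familyM => //; exact: regular_family_horner.
have pr0 : 0 < p * r by rewrite mulr_gt0.
have qr0 : 0 < q * r by rewrite mulr_gt0.
(* Both sides become values at x = 0 of functions of x; as [scaled] needs x > 0, the limit is taken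
   from the right. *)
rewrite -F0 -G0 -D0.
rewrite [in X in _ * (_ - X)](_ : k = k * expR (- 0)); last first.
  by rewrite oppr0 expR0 mulr1.
apply: (@ler_cvg_to _ 0^'+ _ _
  (fun x => n.+1%:R * (normc alpha - k * expR (- x)) * circle_Lnorm r (F x))
  (fun x => circle_Lnorm (p * r) (G x) * circle_Lnorm (q * r) (D x))).
- apply: cvg_at_right_filter; apply: cvgM; last exact: circle_Lnorm_cvg.
  apply: cvgM; first exact: cvg_cst.
  apply: cvgB; first exact: cvg_cst.
  apply: cvgM; first exact: cvg_cst.
  apply: (@continuous_comp _ _ _ (fun x : R => - x) expR).
    exact: opp_continuous.
  exact: continuous_expR.
- by apply: cvg_at_right_filter; apply: cvgM; exact: circle_Lnorm_cvg.
- by near=> x; apply: scaled; near: x; exact: nbhs_right_gt.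
Unshelve. all: by end_near.
Qed.
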